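(* Let $k \geq 2$ be an integer and let $(P_n^{(k)})_{n\in\mathbb{Z}}$ be the $k$-generalized Pell sequence extended to all integer indices. Let $n$ be the largest nonnegative integer such that $P_{-n}^{(k)} = 0$. Then: (i) if $k$ is even, $n < 2k^{k^2}\log(16k^2)$; (ii) if $k$ is odd, $n < 7.5 \cdot 10^{14} \cdot 1.59^{k^3} \cdot k^{10} \cdot (\log k)^2$.
   Context: For an integer $k\geq 2$, the $k$-generalized Pell sequence is defined by $P_n^{(k)} = 0$ for $n = -(k-2), -(k-3), \ldots, 0$, $P_1^{(k)} = 1$, and $P_n^{(k)} = 2P_{n-1}^{(k)} + P_{n-2}^{(k)} + \cdots + P_{n-k}^{(k)}$ for all $n \geq 2$. It is extended to all negative indices by the relation $P_{n-k}^{(k)} = P_n^{(k)} - 2P_{n-1}^{(k)} - P_{n-2}^{(k)} - \cdots - P_{n-(k-1)}^{(k)}$ (applied for decreasing $n$). Here $\log$ is the natural logarithm. *)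

(* Defs.v *)
From Stdlib Require Import ZArith List Reals.
Import ListNotations.
Open Scope Z_scope.

(* A window of the sequence at index m is the list
     [P_m; P_{m-1}; ...; P_{m-k+1}]   (length k).             *)

(* Window at index 1: P_1 = 1, P_0 = ... = P_{-(k-2)} = 0. *)
Definition pell_init (k : nat) : list Z := 1 :: repeat 0 (k - 1).

Definition zsum (l : list Z) : Z := fold_right Z.add 0 l.

(* Forward step: window at m  ->  window at m+1, using
   P_{m+1} = 2 P_m + P_{m-1} + ... + P_{m+1-k}. *)
Definition pell_fwd (s : list Z) : list Z :=
  match s with
  | [] => []
  | x :: _ => (x + zsum s) :: removelast s
  end.

(* Backward step: window at m  ->  window at m-1, using
   P_{m-k} = P_m - 2 P_{m-1} - P_{m-2} - ... - P_{m-(k-1)}. *)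
Definition pell_bwd (s : list Z) : list Z :=
  match s with
  | [] => []
  | x :: t =>
      match t with
      | [] => [x]
      | y :: _ => t ++ [x - y - zsum t]
      end
  end.

Definition pell (k : nat) (n : Z) : Z :=
  if 1 <=? n
  then hd 0 (Nat.iter (Z.to_nat (n - 1)) pell_fwd (pell_init k))
  else hd 0 (Nat.iter (Z.to_nat (1 - n)) pell_bwd (pell_init k)).

(* Main.v *)
(** Put [u_j = P_(1-j)], so that [u_(j+k+1) = 3 u_(j+1) - u_j - u_(j+2)].

    For even [k], [w_j = (-1)^j u_j] satisfies [w_(j+k+1) = w_j + 3 w_(j+1) + w_(j+2)], hence is
    nonnegative, and by induction on [m >= 1] it is positive for [m (k-1) < j <= m (k+1)].  These
    intervals cover all [j >= k^2].

    For odd [k >= 7], [u_(n+1)] is the sum of [x^n / f'(x)] over the roots [x] of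
    [f = 1 + X + ... + X^k + X - 2].  The roots of largest modulus are a conjugate pair [z], [w],
    and the other roots are smaller by a factor [1 - (32 k)^-3].  With [a = z / w], a zero at
    [n] therefore makes [a^n + f'(z) / f'(w)] exponentially small.  This contradicts a lower
    bound for linear forms in two logarithms, proved by Laurent's interpolation determinants in
    multiplicative form: choose [p] with [b = a^p] close to 1 and write [n = q p + t], so that
    [c = - f'(z) / f'(w) a^-t] is extremely close to [b^q].  The determinant with entries
    [binomial (r + s q, i) (b^r c^s)^j] is nonzero for some choice of the points [(r, s)]; it is
    small because its entries are almost polynomials in [r + s q] that are well approximated by
    polynomials of low degree, and Liouville's inequality bounds it from below.

    For [k = 3] and [k = 5] the zeros are found [p]-adically, with [p = 3] and [p = 103]. *)

Require Import Defs.
From Stdlib Require Import ZArith Reals.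
From Stdlib Require Import List Lia Lra.
From HB Require Import structures.
From mathcomp Require all_boot all_order all_fingroup all_algebra all_field.
From mathcomp Require zify ssrZ ring lra.

(** For odd [k] no complex logarithm and no Schwarz lemma occur: Newton's binomial series for
    [(1 + v) ^ x] with small [v = b^j - 1] makes the entries almost polynomial.

    The limit [k >= 7] comes from the separation of the roots, which compares [k / 2] with 3. The
    threshold reached is only polynomial: no zero has [2^l <= n < 2^(l+1)] once
    [2^139 k^33 l^6 <= 2^l]. The stated bound is thus generous for large [k], and the constants are
    tuned to [k = 7]: as [4 < 1.59^3], the factor [1.59^(k^3)] covers [2^(2 k^3 / 3)], and
    [7.5 10^14 7^10] covers a further [2^77]. *)

(* [pell_rev k j] is the Pell number of index [1 - j]. *)
Definition pell_rev (k j : nat) : Z := hd 0%Z (Nat.iter j pell_bwd (pell_init k)).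

(** * Running the recurrence backwards *)

Lemma pell_pell_rev k n : pell k (- Z.of_nat n) = pell_rev k (S n).
Proof.
  unfold pell, pell_rev. destruct (Z.leb_spec 1 (- Z.of_nat n)); [lia|].
  now replace (Z.to_nat (1 - - Z.of_nat n)) with (S n) by lia.
Qed.

(** After a backward step the window sum telescopes to the difference of the two leading entries of
    the old window. The next step subtracts that sum, so two steps leave a recurrence with four
    terms, whatever [k] is. *)
Lemma pell_bwd_spec s : (2 <= length s)%nat ->
  length (pell_bwd s) = length s /\
  (forall i, (S i < length s)%nat -> nth i (pell_bwd s) 0 = nth (S i) s 0) /\
  nth (length s - 1) (pell_bwd s) 0 = 2 * hd 0 s - nth 1 s 0 - zsum s /\
  zsum (pell_bwd s) = hd 0 s - nth 1 s 0.
Proof.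
  destruct s as [|x [|y t]]; cbn [length]; intros Hs; [lia|lia|].
  set (z := x - y - zsum (y :: t)).
  assert (Hb : pell_bwd (x :: y :: t) = (y :: t) ++ (z :: nil)) by reflexivity.
  assert (Hsum : forall l, zsum (l ++ (z :: nil)) = zsum l + z).
  { unfold zsum; induction l as [|a l IH]; cbn; [lia|rewrite IH; lia]. }
  rewrite Hb. repeat split.
  - rewrite length_app. cbn [length]. lia.
  - intros i Hi. rewrite app_nth1 by (cbn [length]; lia). reflexivity.
  - rewrite app_nth2 by (cbn [length]; lia).
    replace (S (S (length t)) - 1 - length (y :: t))%nat with O by (cbn [length]; lia).
    unfold z, zsum. cbn [hd nth fold_right]. lia.
  - rewrite Hsum. unfold z, zsum. cbn [hd nth fold_right]. lia.
Qed.

Section Backward.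
Variable k : nat.
Hypothesis hk : (2 <= k)%nat.

Let window j := Nat.iter j pell_bwd (pell_init k).

Lemma window_length j : length (window j) = k.
Proof.
  induction j as [|j IH].
  - change (S (length (repeat 0 (k - 1))) = k). rewrite repeat_length. lia.
  - change (length (pell_bwd (window j)) = k).
    destruct (pell_bwd_spec (window j)) as [H _]; [lia|congruence].
Qed.

Lemma window_nth i : forall j, (i < k)%nat -> nth i (window j) 0 = pell_rev k (j + i).
Proof.
  induction i as [|i IH]; intros j Hi.
  - rewrite Nat.add_0_r. unfold pell_rev. fold (window j). destruct (window j); reflexivity.
  - destruct (pell_bwd_spec (window j)) as [_ [H _]]; [rewrite window_length; lia|].
    rewrite <- H by (rewrite window_length; lia).
    change (pell_bwd (window j)) with (window (S j)).
    rewrite IH by lia. f_equal. lia.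
Qed.

Lemma pell_rev_rec j : pell_rev k (j + S k) = 3 * pell_rev k (S j) - pell_rev k j - pell_rev k (S (S j)).
Proof.
  assert (Hl : forall i, (2 <= length (window i))%nat) by (intros i; rewrite window_length; lia).
  destruct (pell_bwd_spec (window j) (Hl j)) as [_ [_ [_ Hz]]].
  destruct (pell_bwd_spec (window (S j)) (Hl (S j))) as [_ [_ [Hn _]]].
  change (pell_bwd (window j)) with (window (S j)) in Hz.
  change (pell_bwd (window (S j))) with (window (S (S j))) in Hn.
  rewrite window_length, !window_nth in Hn by lia.
  rewrite window_nth in Hz by lia.
  change (hd 0 (window j)) with (pell_rev k j) in Hz.
  change (hd 0 (window (S j))) with (pell_rev k (S j)) in Hn.
  replace (j + S k)%nat with (S (S j) + (k - 1))%nat by lia.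
  rewrite Hn, Hz. replace (S j + 1)%nat with (S (S j)) by lia.
  replace (j + 1)%nat with (S j) by lia. lia.
Qed.

Lemma pell_rev_0 : pell_rev k 0 = 1.
Proof. reflexivity. Qed.

Lemma pell_rev_small j : (0 < j < k)%nat -> pell_rev k j = 0.
Proof.
  intros Hj. change j with (0 + j)%nat at 1. rewrite <- window_nth by lia.
  change (window 0) with (pell_init k). unfold pell_init. destruct j as [|j]; [lia|].
  cbn [nth]. apply nth_repeat.
Qed.

Lemma pell_rev_k : pell_rev k k = 1.
Proof.
  assert (Hl : (2 <= length (window 0))%nat) by (rewrite window_length; lia).
  destruct (pell_bwd_spec (window 0) Hl) as [_ [_ [Hn _]]].
  change (pell_bwd (window 0)) with (window 1) in Hn.
  rewrite window_length, !window_nth in Hn by lia.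
  replace (1 + (k - 1))%nat with k in Hn by lia.
  rewrite Hn, pell_rev_small by lia.
  change (hd 0 (window 0)) with 1. change (zsum (window 0)) with (1 + zsum (repeat 0 (k - 1))).
  assert (H : forall m, zsum (repeat 0 m) = 0).
  { unfold zsum; induction m as [|m IH]; cbn; [reflexivity|now rewrite IH]. }
  rewrite H. reflexivity.
Qed.

(** * Positivity for even [k] *)

Section EvenCase.
Hypothesis keven : Nat.even k = true.

Let w j := if Nat.even j then pell_rev k j else - pell_rev k j.

Lemma w_rec j : w (j + S k) = w j + 3 * w (S j) + w (S (S j)).
Proof.
  assert (E : Nat.even (j + S k) = negb (Nat.even j)).
  { rewrite Nat.even_add, Nat.even_succ, <- Nat.negb_even, keven. now destruct (Nat.even j). }
  unfold w. rewrite pell_rev_rec, E. change (Nat.even (S (S j))) with (Nat.even j).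
  rewrite Nat.even_succ, <- Nat.negb_even.
  destruct (Nat.even j); cbn [negb]; ring.
Qed.

Lemma w_nonneg j : 0 <= w j.
Proof.
  induction j as [j IH] using (well_founded_induction lt_wf).
  destruct (Nat.lt_ge_cases k j) as [Hj|Hj].
  - replace j with ((j - S k) + S k)%nat by lia. rewrite w_rec.
    assert (H0 := IH (j - S k)%nat ltac:(lia)).
    assert (H1 := IH (S (j - S k))%nat ltac:(lia)).
    assert (H2 := IH (S (S (j - S k)))%nat ltac:(lia)). lia.
  - unfold w. destruct (Nat.eq_dec j 0) as [->|H0]; [rewrite pell_rev_0; cbn; lia|].
    destruct (Nat.eq_dec j k) as [->|H1]; [rewrite keven, pell_rev_k; lia|].
    rewrite pell_rev_small by lia. destruct (Nat.even j); lia.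
Qed.

(** By the recurrence and nonnegativity, positivity on an interval passes to its translates by
    [k - 1] and [k + 1]. These two translates overlap or touch, and together they form the next
    interval. *)
Lemma w_pos m : forall j, (S m * (k - 1) + 1 <= j <= S m * (k + 1))%nat -> 0 < w j.
Proof.
  induction m as [|m IH]; intros j Hj.
  - destruct (Nat.eq_dec j k) as [->|H1]; [unfold w; rewrite keven, pell_rev_k; lia|].
    replace j with (0 + S k)%nat by lia. rewrite w_rec.
    assert (H2 := w_nonneg 1). assert (H3 := w_nonneg 2).
    unfold w at 1. rewrite pell_rev_0. cbn [Nat.even]. lia.
  - assert (Hk : (k - 1 >= 1)%nat) by lia.
    assert (E1 : (S (S m) * (k - 1) = S m * (k - 1) + (k - 1))%nat) by ring.
    assert (E2 : (S (S m) * (k + 1) = S m * (k + 1) + (k + 1))%nat) by ring.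
    assert (E3 : (S m * (k + 1) = S m * (k - 1) + 2 * S m)%nat) by nia.
    assert (E4 : (S m * (k - 1) >= 1)%nat) by nia.
    replace j with ((j - S k) + S k)%nat by lia. rewrite w_rec.
    assert (H0 := w_nonneg (j - S k)). assert (H1 := w_nonneg (S (j - S k))).
    assert (H2 := w_nonneg (S (S (j - S k)))).
    destruct (Nat.le_gt_cases (S m * (k - 1) + 1) (j - S k)) as [H3|H3].
    + assert (H4 := IH (j - S k)%nat ltac:(lia)). lia.
    + assert (H4 := IH (S (S (j - S k)))%nat ltac:(lia)). lia.
Qed.

Lemma pell_rev_even_neq0 j : (k * k <= j)%nat -> pell_rev k j <> 0.
Proof.
  intros Hj H0. set (m := ((j - 1) / (k - 1))%nat).
  assert (Hd := Nat.div_mod (j - 1) (k - 1) ltac:(lia)).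
  assert (Hr := Nat.mod_upper_bound (j - 1) (k - 1) ltac:(lia)).
  fold m in Hd. assert (Hm : (k + 1 <= m)%nat).
  { apply Nat.div_le_lower_bound; [lia|nia]. }
  destruct m as [|m']; [lia|].
  assert (Hp := w_pos m' j). revert Hp. unfold w. rewrite H0.
  destruct (Nat.even j); intros Hp; cbn in Hp; enough (0 < 0) by lia; apply Hp; split; nia.
Qed.

End EvenCase.
End Backward.

Module TwoLogarithms.

Import all_boot all_order all_fingroup all_algebra all_field zify ssrZ ring lra.
Import Order.TTheory GRing.Theory Num.Theory.
Set Implicit Arguments. Unset Strict Implicit. Unset Printing Implicit Defensive.
Local Open Scope ring_scope.

(** * Conjugates of algebraic integers *)

Local Notation pQtoC := (map_poly (ratr : rat -> algC)).

(** The isomorphism from [Q(x)] to [Q(y)] extends to a splitting field of the common minimal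
    polynomial, and from there to [algC]. Conjugates can thus be handled by automorphisms of [algC],
    without fixing a number field. *)
Lemma algC_conjugate (x y : algC) :
  root (minCpoly x) y -> exists nu : {rmorphism algC -> algC}, nu x = y.
Proof.
move=> ry.
have [p [Dp mon_p] min_p] := minCpolyP x.
have [r Dr] := closed_field_poly_normal (minCpoly x).
rewrite (monicP (minCpoly_monic x)) scale1r in Dr.
have rx : x \in r by rewrite -root_prod_XsubC -Dr root_minCpoly.
have {}ry : y \in r by rewrite -root_prod_XsubC -Dr.
have [Qr [QrC [rr Drr genQr]]] := num_field_exists r.
have [xx rrx Dx] : exists2 xx, xx \in rr & x = QrC xx.
  by move: rx; rewrite -Drr => /mapP[xx ? ->]; exists xx.
have [yy rry Dy] : exists2 yy, yy \in rr & y = QrC yy.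
  by move: ry; rewrite -Drr => /mapP[yy ? ->]; exists yy.
have Sinj_poly q : map_poly QrC (map_poly (in_alg Qr) q) = pQtoC q.
  rewrite -map_poly_comp; apply: eq_map_poly => a.
  by rewrite /= rmorphZ_num rmorph1 mulr1.
pose pr := map_poly (in_alg Qr) p.
have Qpr : pr \is a polyOver 1%VS.
  by apply/polyOverP=> i; rewrite coef_map memvZ ?memv_line.
have splitQr : splittingFieldFor 1 pr fullv.
  exists rr => //; congr (_ %= _): (eqpxx pr); apply/(map_poly_inj QrC).
  rewrite Sinj_poly -Dp Dr -Drr big_map rmorph_prod /=; apply: eq_bigr => zz _.
  by rewrite map_polyXsubC.
have homQ1 : kHom 1 1 (\1%VF : 'End(Qr)) by rewrite kHom1.
have prx : root (map_poly \1%VF (minPoly 1 xx)) yy.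
  rewrite -(fmorph_root QrC) -map_poly_comp.
  rewrite (@eq_map_poly _ _ _ QrC) => [|a]; last by rewrite /= id_lfunE.
  set p1 := map_poly _ _.
  have [q1 Dp1]: exists q1, p1 = pQtoC q1.
    have aP i: (minPoly 1 xx)`_i \in 1%VS.
      by apply/polyOverP; apply: minPolyOver.
    have {aP} a_ i := sig_eqW (vlineP _ _ (aP i)).
    exists (\poly_(i < size (minPoly 1 xx)) sval (a_ i)).
    apply/polyP=> i; rewrite coef_poly coef_map coef_poly /=.
    case: ifP => _; rewrite ?rmorph0 //; case: (a_ i) => a /= ->.
    by rewrite alg_num_field fmorph_rat.
  have: root p1 x by rewrite Dx fmorph_root root_minPoly.
  rewrite Dp1 min_p => /dvdpP[r1 ->]; rewrite rmorphM rootM /= -Dp; apply/orP; right.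
  by rewrite -Dy Dr root_prod_XsubC.
pose phi := kHomExtend 1 \1 xx yy.
have homphi : kHom 1 <<1; xx>> phi by apply: kHomExtendP.
have splitQ2 : splittingFieldFor <<1; xx>> pr fullv.
  exact: splittingFieldForS (sub1v _) (subvf _) splitQr.
have [f1 aut_f1 Df1] := kHom_extends (sub1v _) homphi Qpr splitQ2.
pose f1mM := GRing.isMonoidMorphism.Build _ _ f1 (kHom_monoid_morphism aut_f1).
pose phiRM : {rmorphism _ -> _} := HB.pack (fun_of_lfun f1) f1mM.
have [nu Dnu] := extend_algC_subfield_aut QrC phiRM.
exists nu; rewrite Dx -Dnu /= -Df1 ?memv_adjoin // Dy; congr (QrC _).
rewrite -{1}[xx]hornerX /phi.
rewrite (kHomExtend_poly homQ1) ?polyOverX //.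
rewrite map_polyE map_id_in => [|?]; last by rewrite id_lfunE.
by rewrite polyseqK hornerX.
Qed.

Lemma minCpoly_conj_eq (x y : algC) : root (minCpoly x) y -> minCpoly y = minCpoly x.
Proof. by move=> /algC_conjugate[nu <-]; apply: minCpoly_aut. Qed.

Lemma uniq_roots_deriv (F : idomainType) (p : {poly F}) (r : seq F) :
  p = \prod_(x <- r) ('X - x%:P) -> {in r, forall x, p^`().[x] != 0} -> uniq r.
Proof.
move=> Dp dp; apply: contraT => /(uniqPn 0)[i [j [ij jr e]]].
have ir := ltn_trans ij jr.
have := dp _ (mem_nth 0 ir); rewrite Dp (big_nth 0) big_mkord.
rewrite (bigD1 (Ordinal jr)) //= (bigD1 (Ordinal ir)) /=; last by rewrite -val_eqE /= neq_ltn ij.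
rewrite -e !(derivM, derivB, derivX, derivC, hornerD, hornerM, hornerN, hornerX, hornerC).
by rewrite subrr !(mul0r, mulr0, add0r, addr0) eqxx.
Qed.

(** A multiple root would have the same minimal polynomial, which would then divide its own
    derivative. *)
Lemma minCpoly_split (x : algC) :
  exists2 r, uniq r & minCpoly x = \prod_(y <- r) ('X - y%:P).
Proof.
have [r Dr] := closed_field_poly_normal (minCpoly x).
rewrite (monicP (minCpoly_monic x)) scale1r in Dr.
exists r => //; apply: (uniq_roots_deriv Dr) => y yr; apply/negP => rdy.
have Dy : minCpoly y = minCpoly x by apply: minCpoly_conj_eq; rewrite Dr root_prod_XsubC.
have [p [Dp mon_p] min_p] := minCpolyP y.
have dvd : p %| p^`() by rewrite -min_p -deriv_map -Dp Dy.
have p0 : p != 0 by exact: monic_neq0.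
have szp : (1 < size p)%N.
  by have := size_minCpoly y; rewrite Dp size_map_poly.
have dp0 : p^`() != 0.
  apply/eqP => /polyP/(_ (size p).-2); rewrite coef_deriv coef0 prednK; last by case: (size p) szp => [|[]].
  rewrite -/(lead_coef p) (monicP mon_p) => /eqP; rewrite pnatr_eq0.
  by case: (size p) szp => [|[]].
by have := dvdp_leq dp0 dvd; rewrite leqNgt lt_size_deriv.
Qed.

Lemma minCpoly_coef0_int (x : algC) r : x \in Aint -> x != 0 ->
  minCpoly x = \prod_(y <- r) ('X - y%:P) -> 1 <= `|\prod_(y <- r) y|.
Proof.
move=> Ax x0 Dr.
have c0 : (minCpoly x)`_0 = (-1) ^+ (size r) * \prod_(y <- r) y.
  rewrite -horner_coef0 Dr horner_prod.
  under eq_bigr do rewrite hornerXsubC sub0r -mulN1r.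
  by rewrite big_split /= big_const_seq count_predT iter_mulr_1.
have nz : \prod_(y <- r) y != 0.
  rewrite prodf_seq_neq0; apply/allP => y yr /=.
  have : root (minCpoly x) y by rewrite Dr root_prod_XsubC.
  by move=> /algC_conjugate[nu <-]; rewrite fmorph_eq0.
have /polyOverP/(_ 0%N) : minCpoly x \is a polyOver Num.int by [].
rewrite c0 => /norm_intr_ge1; rewrite mulf_neq0 ?signr_eq0 // => /(_ isT).
by rewrite normrM normr_sign mul1r.
Qed.

(* Liouville's inequality: the product of the conjugates is a nonzero integer. *)
Lemma liouville (a M : algC) (s : seq algC) :
  a \in Aint -> a != 0 -> 1 <= M ->
  (forall nu : {rmorphism algC -> algC}, nu a \in s) ->
  (forall nu : {rmorphism algC -> algC}, `|nu a| <= M) ->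
  1 <= `|a| * M ^+ size s.
Proof.
move=> Aa a0 M1 sa Ma.
have [r ur Dr] := minCpoly_split a.
have conjr y : y \in r -> exists nu : {rmorphism algC -> algC}, nu a = y.
  by rewrite -root_prod_XsubC -Dr; apply: algC_conjugate.
have ra : a \in r by rewrite -root_prod_XsubC -Dr root_minCpoly.
have := minCpoly_coef0_int Aa a0 Dr; rewrite normr_prod => /le_trans; apply.
rewrite (big_rem a) //=; apply: ler_wpM2l => //.
have le1 : \prod_(y <- rem a r) `|y| <= M ^+ size (rem a r).
  rewrite -(iter_mulr_1 (size _)) -(count_predT (rem a r)) -big_const_seq.
  rewrite !big_seq; apply: ler_prod => y yr; rewrite normr_ge0 /=.
  by have [nu <-] := conjr y (mem_rem yr); apply: Ma.
apply: (le_trans le1); apply: ler_weXn2l => //.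
rewrite size_rem //; apply: (leq_trans (leq_pred _)); apply: uniq_leq_size => // y yr.
by have [nu <-] := conjr y yr; apply: sa.
Qed.

(** The product of the conjugates has norm at least 1. Applied to a root of [f], this bounds the
    largest root from below; applied to its inverse, it moves the root into the closed unit disc. *)
Lemma exists_large_conj (a : algC) : a \in Aint -> a != 0 ->
  exists nu : {rmorphism algC -> algC}, 1 <= `|nu a|.
Proof.
move=> Aa a0.
have [r ur Dr] := minCpoly_split a.
have ra : a \in r by rewrite -root_prod_XsubC -Dr root_minCpoly.
have [/hasP[y yr y1]|/hasPn small] := boolP (has (fun y => 1 <= `|y|) r).
  have [|nu nua] := @algC_conjugate a y; first by rewrite Dr root_prod_XsubC.
  by exists nu; rewrite nua.
have := minCpoly_coef0_int Aa a0 Dr; rewrite normr_prod (big_rem a) //=.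
have lt1 y : y \in r -> `|y| < 1.
  by move=> /small; rewrite real_ltNge.
suff : `|a| * \prod_(y <- rem a r) `|y| < 1 by move=> /lt_geF ->.
apply: (@le_lt_trans _ _ `|a|); last exact: lt1.
rewrite -[leRHS]mulr1; apply: ler_wpM2l => //.
apply: (@le_trans _ _ (\prod_(y <- rem a r | y \in rem a r) 1)); last by rewrite big1_eq.
rewrite big_seq.
apply: ler_prod => y yr; rewrite normr_ge0 /= ltW //.
by apply: lt1; apply: mem_rem yr.
Qed.

(** * Interpolation determinants *)

(** The smallest sum is [0 + 1 + ... + (size s - 1)]. With a factor [2 ^ e] attached to each degree
    [e], this becomes the gain [2 ^ 'C(N, 2)] of the determinant. *)
Lemma binomial_le_sum_uniq (s : seq nat) : uniq s -> ('C(size s, 2) <= \sum_(x <- s) x)%N.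
Proof.
elim: {s}(size s) {-2}s (erefl (size s)) => [|n IHn] s sz us; first by rewrite sz bin0n.
have [x xs nx] : exists2 x, x \in s & (n <= x)%N.
  apply/hasP; apply: contraT => /hasPn small.
  suff: (size s <= size (iota 0 n))%N by rewrite size_iota sz ltnn.
  apply: uniq_leq_size => // x xs; rewrite mem_iota add0n /=.
  by have := small x xs; rewrite -ltnNge.
rewrite (big_rem x) //= sz binS bin1 addnC leq_add //.
have sz' : size (rem x s) = n by rewrite size_rem // sz.
by have := IHn _ sz' (rem_uniq x us); rewrite sz'.
Qed.

Lemma bin2D_le m d : ('C(m + d, 2) <= 'C(m, 2) + d * (m + d))%N.
Proof.
elim: d => [|d IHd]; first by rewrite addn0 mul0n addn0.
rewrite addnS binS bin1; nia.
Qed.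

Lemma det_expand (R : comNzRingType) N (O : finType) (B : 'I_N -> O -> 'I_N -> R) :
  \det (\matrix_(i, j) \sum_o B i o j) =
  \sum_(phi : {ffun 'I_N -> O}) \det (\matrix_(i, j) B i (phi i) j).
Proof.
rewrite /determinant exchange_big /=; apply: eq_bigr => s _.
rewrite -mulr_sumr; congr (_ * _).
under eq_bigr do rewrite mxE.
rewrite bigA_distr_bigA /=; apply: eq_bigr => phi _.
by apply: eq_bigr => i _; rewrite mxE.
Qed.

Lemma norm_det_le (C : numDomainType) N (A : 'M[C]_N) (b : 'I_N -> C) :
  (forall i j, `|A i j| <= b i) -> `|\det A| <= N`!%:R * \prod_i b i.
Proof.
move=> Ab; rewrite /determinant; apply: (le_trans (ler_norm_sum _ _ _)).
apply: (@le_trans _ _ (\sum_(s : 'S_N) \prod_i b i)); last first.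
  by rewrite sumr_const card_Sn mulr_natl.
apply: ler_sum => s _; rewrite normrM normr_sign mul1r normr_prod.
by apply: ler_prod => i _; rewrite normr_ge0 Ab.
Qed.

(** [phi] picks for each row a degree or an error term. The degrees picked are distinct, and an
    error row weighs [N], at least as much as one more distinct degree would have to. *)
Lemma sum_weight_ge N M (phi : 'I_N -> option 'I_M) :
  (forall i j, i != j -> phi i = phi j -> phi i = None) ->
  ('C(N, 2) <= \sum_i (if phi i is Some e then val e else N))%N.
Proof.
move=> inj.
rewrite (bigID (fun i => phi i != None)) /=.
pose v i := if phi i is Some e then val e else N.
pose s := [seq i <- enum 'I_N | phi i != None].
have us : uniq (map v s).
  rewrite map_inj_in_uniq; first by apply: filter_uniq; apply: enum_uniq.
  move=> i j.
  rewrite !mem_filter => /andP[pi _] /andP[pj _] vij; apply/eqP; apply: contraT => nij.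
  have := inj i j nij; rewrite /v in vij *.
  case: (phi i) pi vij => // a _; case: (phi j) pj => // b _ /val_inj -> /(_ erefl) //.
have := binomial_le_sum_uniq us; rewrite big_map big_filter big_enum_cond /= => h1.
have sz : size (map v s) = #|[pred i | phi i != None]|.
  by rewrite size_map -sum1_size big_filter big_enum_cond /= sum1_card.
rewrite sz in h1.
have -> : (\sum_(i < N | ~~ (phi i != None)) (if phi i is Some e then val e else N) =
   #|[pred i | phi i == None]| * N)%N.
  rewrite -sum_nat_const; apply: eq_big => [i|i]; rewrite ?negbK // => /eqP -> //.
have cN : (#|[pred i | phi i != None]| + #|[pred i | phi i == None]| = N)%N.
  rewrite -[RHS](card_ord N) -(cardC [pred i | phi i != None]); congr addn.
  by apply: eq_card => i; rewrite !inE negbK.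
apply: (@leq_trans ('C(#|[pred i | phi i != None]|, 2) + #|[pred i | phi i == None]| * N)).
  have := bin2D_le #|[pred i | phi i != None]| #|[pred i | phi i == None]|.
  by rewrite cN.
by rewrite leq_add2r.
Qed.

(* An error term counts as a polynomial of degree [N], the largest degree that matters. *)
Lemma interpolation_det_le (C : numDomainType) N M (A : 'M[C]_N)
  (c : 'I_N -> 'I_M -> C) (B : 'I_M -> 'I_N -> C) (E : 'I_N -> 'I_N -> C)
  (b : 'I_M -> C) (eps rho : 'I_N -> C) :
  (forall i j, A i j = \sum_e c i e * B e j + E i j) ->
  (forall e j, `|B e j| <= b e) -> (forall i j, `|E i j| <= eps i) ->
  (forall i, \sum_(e < M) 2 ^+ e * `|c i e| * b e + 2 ^+ N * eps i <= rho i) ->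
  2 ^+ 'C(N, 2) * `|\det A| <= N`!%:R * \prod_i rho i.
Proof.
move=> DA Bb Ee rhoP.
pose F i (o : option 'I_M) j := if o is Some e then c i e * B e j else E i j.
pose G i (o : option 'I_M) := if o is Some e then `|c i e| * b e else eps i.
pose W (o : option 'I_M) := if o is Some e then val e else N.
have -> : A = \matrix_(i, j) \sum_o F i o j.
  apply/matrixP => i j; rewrite mxE DA (bigD1 None) //= addrC; congr (_ + _).
  rewrite (reindex_omap Some id) /=; last by case.
  by apply: eq_bigl => e; rewrite eqxx.
rewrite det_expand.
have two_ge0 n : 0 <= 2 ^+ n :> C by rewrite exprn_ge0.
apply: (@le_trans _ _ (\sum_(phi : {ffun 'I_N -> option 'I_M})
   N`!%:R * \prod_i (2 ^+ W (phi i) * G i (phi i)))).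
  apply: (@le_trans _ _ (\sum_(phi : {ffun 'I_N -> option 'I_M})
     2 ^+ 'C(N, 2) * `|\det (\matrix_(i, j) F i (phi i) j)|)).
    by rewrite -mulr_sumr; apply: ler_wpM2l => //; apply: ler_norm_sum.
  apply: ler_sum => phi _.
  have G0 i : 0 <= G i (phi i).
    rewrite /G; case: (phi i) => [e|]; last exact: le_trans (Ee i i).
    by rewrite mulr_ge0 // (le_trans _ (Bb e i)).
  (* If two rows pick the same degree [e], both are multiples of the row [B e] and the determinant
     vanishes; any other choice has total weight at least ['C(N, 2)]. *)
  have [/forallP inj|/forallPn[i /forallPn[j]]] :=
    boolP [forall i, forall j, (i != j) ==> (phi i == phi j) ==> (phi i == None)].
    have wt : ('C(N, 2) <= \sum_i W (phi i))%N.
      apply: sum_weight_ge => i j nij pij; apply/eqP.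
      by have /forallP/(_ j) := inj i; rewrite nij pij eqxx.
    have h : `|\det (\matrix_(i, j) F i (phi i) j)| <= N`!%:R * \prod_i G i (phi i).
      apply: norm_det_le => i j; rewrite mxE /F /G; case: (phi i) => [e|] //.
      by rewrite normrM ler_wpM2l.
    rewrite big_split /= mulrCA; apply: ler_pM => //.
    by rewrite prodrXr; apply: ler_weXn2l => //; rewrite ler1n.
  rewrite !negb_imply => /and3P[nij /eqP pij].
  case Dp : (phi i) => [e|] // _.
  have -> : \det (\matrix_(i, j) F i (phi i) j) = 0.
    pose d := \row_i (if phi i is Some e then c i e else 1).
    have -> : \matrix_(i, j) F i (phi i) j = diag_mx d *m
       \matrix_(i, j) (if phi i is Some e then B e j else E i j).
      apply/matrixP => i' j'; rewrite mul_diag_mx !mxE /F.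
      by case: (phi i') => [e'|]; rewrite ?mul1r.
    rewrite det_mulmx [X in _ * X](determinant_alternate nij) ?mulr0 // => j'.
    by rewrite !mxE -pij Dp.
  rewrite normr0 mulr0 mulr_ge0 ?ler0n // prodr_ge0 // => i' _.
  by rewrite mulr_ge0.
rewrite -mulr_sumr; apply: ler_wpM2l; first exact: ler0n.
rewrite -(bigA_distr_bigA (fun i o => 2 ^+ W o * G i o)) /=.
apply: ler_prod => i _; apply/andP; split.
  apply: sumr_ge0 => o _; rewrite mulr_ge0 // /G.
  case: o => [e|]; last exact: le_trans (Ee i i).
  by rewrite mulr_ge0 // (le_trans _ (Bb e i)).
apply: le_trans (rhoP i).
rewrite (bigD1 None) //= addrC; apply: lerD => //.
rewrite (reindex_omap Some id) /=; last by case.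
rewrite (eq_bigl xpredT) => [|e]; last by rewrite eqxx.
by apply: ler_sum => e _; rewrite mulrA.
Qed.

Lemma coefM_top (R : nzRingType) (p q : {poly R}) m n :
  (size p <= m.+1)%N -> (size q <= n.+1)%N -> (p * q)`_(m + n) = p`_m * q`_n.
Proof.
move=> sp sq; rewrite coefM.
have hm : (m < (m + n).+1)%N by rewrite ltnS leq_addr.
rewrite (bigD1 (Ordinal hm)) //= addKn big1 ?addr0 // => i; rewrite -val_eqE /= => nim.
have [lim|lmi] := ltnP i m; last first.
  by rewrite nth_default ?mul0r // (leq_trans sp) // ltn_neqAle eq_sym nim.
by rewrite [q`_ _]nth_default ?mulr0 // (leq_trans sq) //; lia.
Qed.

Lemma coef_prod_top (R : nzRingType) (I : finType) (p : I -> {poly R}) (d : I -> nat) :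
  (forall i, size (p i) <= (d i).+1)%N ->
  (size (\prod_i p i)%R <= (\sum_i d i).+1)%N /\
  (\prod_i p i)`_(\sum_i d i)%N = \prod_i (p i)`_(d i).
Proof.
move=> sp.
elim/big_rec3: _ => [|i m x y _ [sy <-]]; first by rewrite size_poly1 coefC.
split; last by rewrite coefM_top.
apply: leq_trans (size_polyMleq _ _) _.
by have := leq_add (sp i) sy; rewrite addSn addnS; case: (_ + _)%N => //= n; lia.
Qed.

(* Laurent's zero estimate.  Translating by the first [L] points gives [L] relations between the
   values [y ^+ b] at each remaining point, so a polynomial determinant of small degree vanishes
   there; its leading coefficient is a Vandermonde determinant in the powers of [beta]. *)
Lemma zero_estimate (F : numFieldType) (K L T S q : nat) (beta gamma : F)
    (p : 'I_L -> {poly F}) :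
  (forall b, size (p b) <= K)%N -> beta != 0 -> gamma != 0 ->
  {in gtn L &, injective (fun i => beta ^+ i)} ->
  (T <= q)%N -> (K.-1 * L < T * S)%N ->
  (forall r s, (r < T + L)%N -> (s < S)%N ->
     \sum_b (p b).[(r + s * q)%:R] * (beta ^+ r * gamma ^+ s) ^+ b = 0) ->
  forall b, p b = 0.
Proof.
move=> szp beta0 gamma0 injb Tq KLTS vanish b0; apply/eqP; apply: contraT => pb0.
have K0 : (0 < K)%N by rewrite (leq_trans _ (szp b0)) // size_poly_gt0.
(* Zero polynomials are replaced by 1, so that every column has a nonzero leading coefficient; the
   relation at each point gets the entry 0 in these columns. *)
pose pt b := if p b == 0 then 1 else p b.
have pt0 b : pt b != 0 by rewrite /pt; case: ifP => [_|/negbT//]; apply: oner_neq0.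
have szpt b : (size (pt b) <= K)%N.
  by rewrite /pt; case: ifP => // _; rewrite size_poly1.
pose d b := (size (pt b)).-1.
have dE b : (d b).+1 = size (pt b) by rewrite prednK // size_poly_gt0.
pose M := \matrix_(j < L, b < L) ((beta ^+ (j * b))%:P * (pt b \Po ('X + (j%:R)%:P))).
have szM j b : (size (M j b) <= (d b).+1)%N.
  rewrite mxE dE mul_polyC; apply: leq_trans (size_scale_leq _ _) _.
  by rewrite size_comp_poly2 // size_XaddC.
have topM j b : (M j b)`_(d b) = beta ^+ (j * b) * lead_coef (pt b).
  rewrite mxE coefCM; congr (_ * _).
  have szc : size (pt b \Po ('X + (j%:R)%:P)) = size (pt b).
    by rewrite size_comp_poly2 // size_XaddC.
  rewrite /d -szc -/(lead_coef _) lead_coef_comp ?size_XaddC //.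
  by rewrite lead_coefXaddC expr1n mulr1.
pose D := (\sum_b d b)%N.
have perD (s : 'S_L) : (\sum_j d (s j) = D)%N by rewrite /D [RHS](reindex_inj (@perm_inj _ s)).
have szdet : (size (\det M) <= D.+1)%N.
  rewrite /determinant; apply: leq_trans (size_sum _ _ _) _; apply/bigmax_leqP => s _.
  rewrite -polyCN -polyC1 -polyC_exp mul_polyC; apply: leq_trans (size_scale_leq _ _) _.
  by rewrite -(perD s); apply: (coef_prod_top (fun j => szM j (s j))).1.
have topdet : (\det M)`_D = (\prod_b lead_coef (pt b)) * \det (\matrix_(j < L, b < L) (beta ^+ j) ^+ b).
  rewrite /determinant coef_sum mulr_sumr; apply: eq_bigr => s _.
  rewrite -polyCN -polyC1 -polyC_exp coefCM mulrCA; congr (_ * _).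
  rewrite -{1}(perD s) (coef_prod_top (fun j => szM j (s j))).2.
  rewrite [X in X * _](reindex_inj (@perm_inj _ s)) -big_split /=.
  by apply: eq_bigr => j _; rewrite topM mxE exprM mulrC.
have vdm : \det (\matrix_(j < L, b < L) (beta ^+ j) ^+ b) != 0.
  have -> : \matrix_(j < L, b < L) (beta ^+ j) ^+ b = (Vandermonde L (\row_j beta ^+ j))^T.
    by apply/matrixP => i j; rewrite !mxE.
  rewrite det_tr det_Vandermonde; apply/prodf_neq0 => i _; apply/prodf_neq0 => j ij.
  rewrite !mxE subr_eq0; apply/eqP => /injb; rewrite !inE => /(_ (ltn_ord _) (ltn_ord _)) e.
  by rewrite e ltnn in ij.
have det0 : \det M != 0.
  apply/eqP => e; move: topdet; rewrite e coef0 => /esym/eqP; rewrite mulf_eq0 (negPf vdm) orbF.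
  by apply/negP/prodf_neq0 => b _; rewrite lead_coef_eq0.
have leD : (D <= K.-1 * L)%N.
  rewrite -[L in leqRHS]card_ord mulnC -sum_nat_const; apply: leq_sum => b _.
  by rewrite -ltnS dE prednK.
(* These points are distinct because [r < T <= q] makes [r] and [s] the remainder and the quotient
   by [q]. They outnumber the degree of the determinant, which is at most [K.-1 * L]. *)
pose pts := [seq (r + s * q)%:R | r <- iota 0 T, s <- iota 0 S] : seq F.
have upts : uniq pts.
  apply: allpairs_uniq; rewrite ?iota_uniq // => -[r s] [r' s'] /=.
  move=> /allpairsP[[a b] [/= + _ [-> ->]]] /allpairsP[[a' b'] [/= + _ [-> ->]]].
  rewrite !mem_iota /= !add0n => la la' /eqP; rewrite eqr_nat => /eqP e.
  have q0 : (0 < q)%N by lia.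
  have := congr1 (divn^~ q) e; have := congr1 (modn^~ q) e.
  rewrite ![(_ + _ * q)%N]addnC !modnMDl !divnMDl // !modn_small ?divn_small ?addn0; try lia.
  by move=> -> ->.
have rpts : all (root (\det M)) pts.
  apply/allP => x /allpairsP[[r s] [/= + + ->]]; rewrite !mem_iota /= !add0n => lr ls.
  set y := beta ^+ r * gamma ^+ s.
  have y0 : y != 0 by rewrite mulf_neq0 ?expf_neq0.
  rewrite /root -[_.[_]]/(horner_eval _ _) -det_map_mx -det_tr; apply/det0P.
  exists (\row_b (if p b == 0 then 0 else y ^+ b)).
    apply/eqP => /rowP/(_ b0); rewrite !mxE (negPf pb0) => /eqP.
    by rewrite expf_eq0 (negPf y0) andbF.
  apply/rowP => j; rewrite !mxE.
  rewrite -[RHS](vanish (r + j)%N s) //; last by rewrite -addnS leq_add // ltnW.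
  apply: eq_bigr => b _; rewrite !mxE /= /horner_eval hornerM hornerC horner_comp !hornerE.
  rewrite /pt -[LHS]/(_ * _ * _).
  case: (altP (p b =P 0)) => [->|_]; first by rewrite !horner0 !mul0r.
  rewrite /y [beta ^+ (r + j)]exprD -!mulrA !exprMn -!exprM -!natrD.
  have -> : (r + s * q + j = r + j + s * q)%N by lia.
  by ring.
have := max_poly_roots det0 rpts upts.
rewrite size_allpairs !size_iota => lt1.
have h1 : (T * S <= D)%N by rewrite -ltnS; apply: leq_trans lt1 szdet.
by have := leq_trans h1 leD; rewrite leqNgt KLTS.
Qed.

Section BinomialPolynomial.
Variable F : numFieldType.

Definition binpoly (a : nat) : {poly F} := (a`!%:R)^-1 *: \prod_(i < a) ('X - (i%:R)%:P).

Lemma size_binpoly a : (size (binpoly a) <= a.+1)%N.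
Proof.
apply: leq_trans (size_scale_leq _ _) _.
by rewrite size_prod_XsubC [index_enum _]unlock -enumT size_enum_ord.
Qed.

Lemma horner_binpoly a m : (binpoly a).[m%:R] = 'C(m, a)%:R.
Proof.
have ff : \prod_(i < a) (m%:R - i%:R) = (m ^_ a)%:R :> F.
  elim: a => [|a IHa]; first by rewrite big_ord0 ffactn0.
  rewrite big_ord_recr /= IHa ffactnSr natrM.
  by have [am|ma] := leqP a m; [rewrite natrB | rewrite ffact_small ?mul0r].
rewrite /binpoly hornerZ horner_prod; under eq_bigr do rewrite hornerXsubC.
by rewrite ff -bin_ffact natrM mulrC mulfK // pnatr_eq0 -lt0n fact_gt0.
Qed.

Lemma binpoly_free K (c : 'I_K -> F) :
  \sum_(a < K) c a *: binpoly a = 0 -> forall a, c a = 0.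
Proof.
move=> c0 [m mK]; elim/ltn_ind: m mK => m IHm mK.
have := congr1 (horner^~ m%:R) c0; rewrite horner0 horner_sum.
under eq_bigr do rewrite hornerZ horner_binpoly.
rewrite (bigD1 (Ordinal mK)) //= binn mulr1 big1 ?addr0 // => -[a aK] /=.
rewrite -val_eqE /= neq_ltn => /orP[am|ma]; first by rewrite IHm ?mul0r.
by rewrite bin_small ?mulr0.
Qed.
End BinomialPolynomial.

Definition interp_entry (F : numFieldType) (beta gamma : F) (q a b r s : nat) : F :=
  'C(r + s * q, a)%:R * (beta ^+ r * gamma ^+ s) ^+ b.

(** A relation between the rows is a polynomial in [X] and [Y] that vanishes at all points
    [(r + s q, beta^r gamma^s)], which the zero estimate excludes. The matrix with all points as
    columns therefore has full row rank, and some choice of columns is invertible. *)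
Lemma nonzero_minor (F : numFieldType) (K L T S q : nat) (beta gamma : F) :
  beta != 0 -> gamma != 0 -> {in gtn L &, injective (fun i => beta ^+ i)} ->
  (T <= q)%N -> (K.-1 * L < T * S)%N ->
  exists (g : 'I_(K * L) -> 'I_K * 'I_L) (h : 'I_(K * L) -> 'I_(T + L) * 'I_S),
    \det (\matrix_(i, j) interp_entry beta gamma q (g i).1 (g i).2 (h j).1 (h j).2) != 0.
Proof.
move=> beta0 gamma0 injb Tq KLTS.
have : #|{: 'I_K * 'I_L}| = (K * L)%N by rewrite card_prod !card_ord.
case: _ /; set N := #|_|; pose P := #|{: 'I_(T + L) * 'I_S}|.
pose E (x : 'I_K * 'I_L) (y : 'I_(T + L) * 'I_S) : F :=
  interp_entry beta gamma q x.1 x.2 y.1 y.2.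
pose A := \matrix_(i < N, j < P) E (enum_val i) (enum_val j).
have fA : row_free A.
  apply: inj_row_free => v vA.
  pose p b := \sum_(a < K) v 0 (enum_rank (a, b)) *: binpoly F a.
  have pz b : p b = 0.
    move: b; apply: (zero_estimate (K := K) (T := T) (S := S)) beta0 gamma0 injb Tq KLTS _ => // [b|].
      apply: (leq_trans (size_sum _ _ _)); apply/bigmax_leqP => a _.
      apply: leq_trans (size_scale_leq _ _) _; exact: leq_trans (size_binpoly _ _) _.
    move=> r s rb sS; have := congr1 (fun M : 'rV_P => M 0 (enum_rank (Ordinal rb, Ordinal sS))) vA.
    rewrite !mxE => vA0.
    transitivity (\sum_(j < N) v 0 j * A j (enum_rank (Ordinal rb, Ordinal sS))); last exact: vA0.
    under [RHS]eq_bigr do rewrite mxE enum_rankK.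
    transitivity (\sum_x v 0 (enum_rank x) * E x (Ordinal rb, Ordinal sS)); last first.
      by rewrite big_enum_val; apply: eq_bigr => i _; rewrite enum_valK.
    transitivity (\sum_(a < K) \sum_(b < L) v 0 (enum_rank (a, b)) *
       E (a, b) (Ordinal rb, Ordinal sS)); last by rewrite pair_big; apply: eq_bigr => -[].
    rewrite exchange_big /=.
    apply: eq_bigr => b _; rewrite horner_sum mulr_suml; apply: eq_bigr => a _.
    by rewrite hornerZ horner_binpoly mulrA.
  apply/rowP => i; rewrite mxE -[i]enum_valK; case: (enum_val i) => a b.
  exact: (binpoly_free (pz b) a).
have fAt : row_full A^T by rewrite /row_full mxrank_tr -/(row_free A).
exists enum_val, (fun j => enum_val (fullrankfun fAt j)).
have := fullrowsub_unit fAt; rewrite -unitmx_tr unitmxE unitfE.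
by congr (\det _ != 0); apply/matrixP => i j; rewrite !mxE.
Qed.

Lemma bin_le_exp n m : ('C(n, m) <= n ^ m)%N.
Proof.
elim: m => [|m IHm]; first by rewrite bin0.
apply: (@leq_trans (m.+1 * 'C(n, m.+1))); first by rewrite leq_pmull.
by rewrite mul_bin_left expnS leq_mul // leq_subr.
Qed.

Lemma bin_le_exp2 n m : ('C(n, m) <= 2 ^ n)%N.
Proof.
elim: n m => [|n IHn] [|m]; rewrite ?bin0 ?bin0n ?expn_gt0 //.
by rewrite binS expnS mul2n -addnn leq_add.
Qed.

Lemma bin_trinomial x a d : ('C(x, a + d) * 'C(a + d, a) = 'C(x, a) * 'C(x - a, d))%N.
Proof.
have [adx|xad] := leqP (a + d) x; last first.
  rewrite bin_small //; have [ax|xa] := leqP a x; last by rewrite (bin_small xa).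
  by rewrite [X in (_ = _ * X)%N]bin_small ?muln0 //; lia.
have ax : (a <= x)%N by lia.
have dx : (d <= x - a)%N by lia.
have h1 := bin_fact adx; have h2 := bin_fact ax; have h3 := bin_fact dx.
have h4 := bin_fact (leq_addr d a); rewrite addKn in h4.
have e1 : (x - (a + d) = x - a - d)%N by lia.
rewrite e1 in h1.
have p : (0 < a`! * d`! * (x - a - d)`!)%N by rewrite !muln_gt0 !fact_gt0.
apply/eqP; rewrite -(eqn_pmul2r p); apply/eqP.
rewrite -{}h3 in h2; rewrite -{}h4 in h1; nia.
Qed.

(** This is the binomial theorem after ['C(x, e) * 'C(e, a) = 'C(x, a) * 'C(x - a, e - a)]. For
    small [v] the coefficients of the polynomials ['C(x, e)] decay like [v ^ (e - a)]; the range up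
    to [X] is common to all points. *)
Lemma newton_binomial (R : comNzRingType) (v : R) (x X a : nat) : (x <= X)%N ->
  'C(x, a)%:R * (1 + v) ^+ (x - a) =
  \sum_(e < X.+1) 'C(e, a)%:R * v ^+ (e - a) * 'C(x, e)%:R.
Proof.
move=> xX.
have [ax|xa] := leqP a x; last first.
  rewrite (bin_small xa) mul0r big1 // => e _.
  have [ea|ae] := ltnP e a; first by rewrite (bin_small ea) !mul0r.
  by rewrite [X in _ * X%:R]bin_small ?mulr0 // (leq_trans xa).
rewrite -(big_mkord xpredT (fun e => 'C(e, a)%:R * v ^+ (e - a) * 'C(x, e)%:R)).
rewrite (big_cat_nat (n := a)) //=; last by lia.
rewrite big_nat big1 ?add0r => [|e /andP[_ ea]]; last by rewrite (bin_small ea) !mul0r.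
rewrite (big_cat_nat (n := x.+1)) //=; last by lia.
rewrite [X in _ = _ + X]big_nat [X in _ = _ + X]big1 ?addr0 => [|e /andP[xe _]]; last first.
  by rewrite [X in _ * X%:R]bin_small ?mulr0.
rewrite -[X in index_iota X _]add0n big_addn subSn // big_mkord addrC exprD1n mulr_sumr.
apply: eq_bigr => d _; rewrite addnK -[v ^+ d *+ _]mulr_natr mulrCA -natrM -bin_trinomial natrM.
by rewrite addnC; ring.
Qed.

Lemma norm_subX_le (C : numDomainType) (x y : C) n : `|x| = 1 -> `|y| = 1 ->
  `|x ^+ n - y ^+ n| <= n%:R * `|x - y|.
Proof.
move=> x1 y1; rewrite subrXX normrM mulrC; apply: ler_wpM2r => //.
apply: (le_trans (ler_norm_sum _ _ _)).
rewrite -[n in n%:R]card_ord -sum1_card natr_sum; apply: ler_sum => i _.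
by rewrite normrM !normrX x1 y1 !expr1n mulr1.
Qed.

(** Bernoulli's inequality for the inverse [1 - 1/(m+1)] gives [(1 + 1/m)^j <= 2] as long as
    [2 j <= m + 1], and two such powers cover the exponent [m]. *)
Lemma expr_1DV_le (C : numFieldType) (m X : nat) : (0 < m)%N ->
  (1 + m%:R^-1) ^+ X <= (4 ^ (X %/ m).+1)%:R :> C.
Proof.
move=> m0; have mC : 0 < m%:R :> C by rewrite ltr0n.
have w0 : 0 <= 1 + m%:R^-1 :> C by rewrite addr_ge0 // invr_ge0 ltW.
have small j : (j.*2 <= m.+1)%N -> (1 + m%:R^-1) ^+ j <= 2 :> C.
  move=> jm.
  have m1 : 0 < m.+1%:R :> C by rewrite ltr0n.
  pose t := m.+1%:R^-1 : C.
  have hinv : (1 + m%:R^-1) * (1 - t) = 1 :> C.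
    by rewrite /t -[m.+1]addn1 natrD; field; rewrite natr1 !pnatr_eq0 /= -lt0n m0.
  have bern i : (i <= m.+1)%N -> 1 - i%:R * t <= (1 - t) ^+ i.
    elim: i => [|i IHi] im; first by rewrite mul0r subr0.
    have ht : 0 <= t by rewrite invr_ge0 ltW.
    have ht1 : 0 <= 1 - t by rewrite subr_ge0 invf_le1 // ler1n.
    rewrite exprS; apply: le_trans (ler_wpM2l ht1 (IHi (ltnW im))).
    have -> : (1 - t) * (1 - i%:R * t) = 1 - i.+1%:R * t + i%:R * t * t by rewrite -natr1; ring.
    by rewrite lerDl !mulr_ge0.
  have half : 2^-1 <= (1 - t) ^+ j.
    apply: le_trans (bern j _); last by lia.
    rewrite lerBrDl -lerBrDr; have -> : 1 - 2^-1 = 2^-1 :> C by field.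
    by rewrite /t ler_pdivrMr // mulrC ler_pdivlMr // -natrM ler_nat muln2.
  have e1 : (1 + m%:R^-1) ^+ j * (1 - t) ^+ j = 1 :> C by rewrite -exprMn hinv expr1n.
  have pj : 0 <= (1 + m%:R^-1) ^+ j :> C by rewrite exprn_ge0.
  have := ler_wpM2l pj half; rewrite e1 ler_pdivrMr // mul1r //.
have em : (1 + m%:R^-1) ^+ m <= 4 :> C.
  apply: (@le_trans _ _ ((1 + m%:R^-1) ^+ ((m.+1)./2 + (m.+1)./2))).
    apply: ler_weXn2l; last by lia.
    by rewrite lerDl invr_ge0 ltW.
  rewrite exprD; have -> : 4 = 2 * 2 :> C by rewrite -natrM.
  by apply: ler_pM; rewrite ?exprn_ge0 // small //; lia.
rewrite {1}(divn_eq X m) mulnC exprD exprM expnSr natrM natrX.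
apply: ler_pM; rewrite ?exprn_ge0 //; first by apply: lerXn2r; rewrite ?nnegrE ?exprn_ge0.
apply: le_trans em; apply: ler_weXn2l; last by rewrite ltnW // ltn_pmod.
by rewrite lerDl invr_ge0 ltW.
Qed.

(** With [gamma] replaced by [beta ^ q], at a cost controlled by [err], the entries expand by
    [newton_binomial] with [|v| <= 1 / (4 V)]. The 4 absorbs both the weight [2 ^ e] and
    ['C(e, a) <= 2 ^ e]: the weighted row sum is at most [(4 V)^a] times the sum of ['C(X, e) V^-e],
    that is [(4 V)^a (1 + 1/V)^X]. *)
Lemma interp_det_upper (C : numFieldType) (K L T S q V X : nat) (beta gamma err : C)
    (g : 'I_(K * L) -> 'I_K * 'I_L) (h : 'I_(K * L) -> 'I_(T + L) * 'I_S) :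
  (0 < V)%N -> `|beta| = 1 -> `|gamma| = 1 ->
  `|beta - 1| <= ((4 * L * V)%:R)^-1 -> `|gamma - beta ^+ q| <= err ->
  (T + L + S * q <= X)%N ->
  (2 ^ (K * L) * (X ^ K * (S * L)))%:R * err <= 1 ->
  (2 ^ 'C(K * L, 2))%:R *
    `|\det (\matrix_(i, j) interp_entry beta gamma q (g i).1 (g i).2 (h j).1 (h j).2)|
  <= ((K * L)`! * (2 * ((4 * V) ^ K * 4 ^ (X %/ V).+1)) ^ (K * L))%:R.
Proof.
move=> V0 beta1 gamma1 bV gb leX err1.
pose x j := ((h j).1 + (h j).2 * q)%N.
have xX j : (x j <= X)%N.
  apply: leq_trans leX; rewrite leq_add ?leq_mul //; last exact: ltnW.
  exact: ltnW (ltn_ord (h j).1).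
pose v i := beta ^+ (g i).2 - 1.
pose c (i : 'I_(K * L)) (e : 'I_X.+1) : C :=
  (1 + v i) ^+ (g i).1 * ('C(e, (g i).1)%:R * v i ^+ (e - (g i).1)).
pose B (e : 'I_X.+1) (j : 'I_(K * L)) : C := 'C(x j, e)%:R.
have v1 i : 1 + v i = beta ^+ (g i).2 by rewrite /v addrC subrK.
pose E i j : C := 'C(x j, (g i).1)%:R *
   ((beta ^+ (h j).1 * gamma ^+ (h j).2) ^+ (g i).2 - beta ^+ (x j * (g i).2)).
pose w : C := (4 * V)%:R^-1.
have w0 : 0 < w by rewrite invr_gt0 ltr0n muln_gt0.
have vw i : `|v i| <= w.
  have := norm_subX_le (g i).2 beta1 (normr1 C); rewrite expr1n => /le_trans; apply.
  apply: (@le_trans _ _ (L%:R * ((4 * L * V)%:R)^-1)).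
    by apply: ler_pM => //; rewrite ler_nat ltnW.
  have L0 : (0 < L)%N by apply: leq_ltn_trans (ltn_ord (g i).2).
  rewrite /w mulnAC [(_ * L)%N]mulnC natrM invfM mulrA mulfV ?mul1r //.
  by rewrite pnatr_eq0 -lt0n.
have err0 : 0 <= err by apply: le_trans gb.
have b4 : 0 <= (4 * V)%:R :> C by [].
have w4 : (4 * V)%:R * w = 1 by rewrite mulfV // pnatr_eq0 -lt0n muln_gt0.
have rowP i : \sum_(e < X.+1) 2 ^+ e * `|c i e| * 'C(X, e)%:R + 2 ^+ (K * L) *
    ('C(X, (g i).1)%:R * ((S * L)%:R * err)) <= (2 * ((4 * V) ^ K * 4 ^ (X %/ V).+1))%:R.
  rewrite mul2n -addnn natrD; apply: lerD.
    apply: (@le_trans _ _ ((4 * V)%:R ^+ (g i).1 * (1 + V%:R^-1) ^+ X)); last first.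
      rewrite [leRHS]natrM; apply: ler_pM; rewrite ?exprn_ge0 ?addr_ge0 ?invr_ge0 ?ler0n //.
        rewrite natrX; apply: ler_weXn2l; last exact: ltnW.
        by rewrite ler1n muln_gt0.
      exact: expr_1DV_le.
    rewrite exprDn mulr_sumr; apply: ler_sum => e _.
    rewrite expr1n mul1r -[(_ ^+ e) *+ _]mulr_natr mulrA; apply: ler_wpM2r => //.
    rewrite /c v1 normrM !normrX beta1 !expr1n mul1r normrM normr_nat normrX.
    have [ea|ae] := ltnP e (g i).1.
      by rewrite (bin_small ea) mul0r mulr0 mulr_ge0 // exprn_ge0 // invr_ge0.
    have -> : V%:R^-1 = 2 * 2 * w.
      by rewrite /w natrM; field; rewrite pnatr_eq0 -lt0n V0.
    rewrite !exprMn -[e in w ^+ e](subnK ae) exprD.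
    have -> : (4 * V)%:R ^+ (g i).1 * (2 ^+ e * 2 ^+ e * (w ^+ (e - (g i).1) * w ^+ (g i).1)) =
       2 ^+ e * (2 ^+ e * w ^+ (e - (g i).1)) * ((4 * V)%:R * w) ^+ (g i).1.
      by rewrite exprMn; ring.
    rewrite w4 expr1n mulr1; apply: ler_wpM2l; first exact: exprn_ge0.
    apply: ler_pM; rewrite ?exprn_ge0 //; first by rewrite -natrX ler_nat bin_le_exp2.
    by apply: lerXn2r; rewrite ?nnegrE // ltW.
  apply: (@le_trans _ _ 1); last by rewrite ler1n muln_gt0 !expn_gt0 muln_gt0 V0.
  apply: le_trans err1; rewrite [(2 ^ _ * _)%:R]natrM natrX [(X ^ K * _)%:R]natrM -[leRHS]mulrA.
  apply: ler_wpM2l; first exact: exprn_ge0.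
  rewrite -[leRHS]mulrA; apply: ler_wpM2r; first by rewrite mulr_ge0.
  rewrite ler_nat; apply: leq_trans (bin_le_exp _ _) _.
  apply: leq_pexp2l; last exact: ltnW.
  by apply: leq_trans leX; rewrite !addn_gt0 (leq_ltn_trans _ (ltn_ord (g i).2)) ?orbT.
rewrite [X in X * _ <= _]natrX [leRHS]natrM natrX.
have -> (z : C) : z ^+ (K * L) = \prod_(i < K * L) z by rewrite prodr_const card_ord.
apply: (interpolation_det_le (c := c) (B := B) (E := E) (b := fun e => 'C(X, e)%:R)
   (eps := fun i => 'C(X, (g i).1)%:R * ((S * L)%:R * err))) rowP.
- move=> i j; rewrite mxE /interp_entry -/(x j) /E mulrBr addrC.
  suff <- : 'C(x j, (g i).1)%:R * beta ^+ (x j * (g i).2) = \sum_e c i e * B e j.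
    by rewrite subrK.
  under eq_bigr do rewrite /c /B -!mulrA.
  rewrite -mulr_sumr; under eq_bigr do rewrite mulrA.
  rewrite -newton_binomial //; have [ax|xa] := leqP (g i).1 (x j); last first.
    by rewrite (bin_small xa) !(mul0r, mulr0).
  by rewrite mulrCA -exprD subnKC // v1 -exprM mulnC.
- by move=> e j; rewrite /B normr_nat ler_nat leq_bin2l.
- move=> i j; rewrite /E normrM normr_nat.
  apply: ler_pM => //; first by rewrite ler_nat leq_bin2l.
  have -> : (beta ^+ (h j).1 * gamma ^+ (h j).2) ^+ (g i).2 - beta ^+ (x j * (g i).2) =
      beta ^+ ((h j).1 * (g i).2) *
      (gamma ^+ ((h j).2 * (g i).2) - (beta ^+ q) ^+ ((h j).2 * (g i).2)).
    rewrite mulrBr exprMn -!exprM -exprD; congr (_ - _ ^+ _); rewrite /x; nia.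
  rewrite normrM normrX beta1 expr1n mul1r.
  apply: le_trans (norm_subX_le _ gamma1 _) _; first by rewrite normrX beta1 expr1n.
  by apply: ler_pM => //; rewrite ler_nat leq_mul // ltnW.
Qed.

(** * The Pell polynomial *)

(* The characteristic polynomial of the recurrence run backwards. *)
Definition pellpoly (R : nzRingType) (k : nat) : {poly R} :=
  \sum_(i < k.+1) 'X^i + ('X - 2%:P).

Section GeneralRing.
Variables (R : nzRingType) (k : nat).
Hypothesis k_gt2 : (2 < k)%N.
Local Notation f := (pellpoly R k).

Lemma pellpoly_sum_polyE : \sum_(i < k.+1) 'X^i = \poly_(i < k.+1) 1 :> {poly R}.
Proof. by rewrite poly_def; apply: eq_bigr => i _; rewrite scale1r. Qed.

Lemma size_pellpoly_sum : size (\sum_(i < k.+1) 'X^i : {poly R}) = k.+1.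
Proof. by rewrite pellpoly_sum_polyE size_poly_eq ?oner_eq0. Qed.

Lemma size_pellpoly : size f = k.+1.
Proof.
by rewrite size_polyDl size_pellpoly_sum // size_XsubC ltnS; lia.
Qed.

Lemma monic_pellpoly : f \is monic.
Proof.
rewrite monicE lead_coefDl; last by rewrite size_pellpoly_sum size_XsubC ltnS; lia.
by rewrite /lead_coef size_pellpoly_sum pellpoly_sum_polyE coef_poly ltnSn.
Qed.

Lemma pellpoly_rec_sum (v : nat -> R) j :
  \sum_(i < k.+1) f`_i * v (j + i)%N = \sum_(i < k.+1) v (j + i)%N + (v j.+1 - 2 * v j).
Proof.
rewrite /pellpoly pellpoly_sum_polyE.
under eq_bigr do rewrite !coefD coefN coef_poly ltn_ord coefX coefC mulrDl mul1r mulrBl.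
rewrite big_split sumrB /=; congr (_ + (_ - _)).
  have k1 : (1 < k.+1)%N by lia.
  rewrite (bigD1 (Ordinal k1)) //= mul1r addn1 big1 ?addr0 // => i; rewrite -val_eqE /= => /negPf ->.
  by rewrite mul0r.
rewrite big_ord_recl /= addn0 big1 ?addr0 // => i _.
by rewrite mul0r.
Qed.
End GeneralRing.

Section PellPolynomial.
Variable k : nat.
Hypothesis k_gt2 : (2 < k)%N.
Local Notation f := (pellpoly algC k).

(** The factor [X - 1] leaves four terms, those of the short recurrence. The estimates for the roots
    start from this form. *)
Lemma pellpoly_mulXsub1 : ('X - 1) * f = 'X^(k.+1) + 'X^2 - 'X *+ 3 + 1.
Proof.
rewrite /pellpoly mulrDr -subrX1 (_ : 2%:P = 2%:R); last by rewrite polyC_natr.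
by ring.
Qed.

Lemma horner_pellpoly z : f.[z] = \sum_(i < k.+1) z ^+ i + (z - 2).
Proof.
rewrite /pellpoly hornerD horner_sum hornerXsubC; congr (_ + _).
by apply: eq_bigr => i _; rewrite hornerXn.
Qed.

Lemma pellpoly_rootE z : root f z -> z ^+ k.+1 = 3 * z - z ^+ 2 - 1.
Proof.
move=> /rootP z0; have := congr1 (horner^~ z) pellpoly_mulXsub1.
rewrite hornerM z0 mulr0 !(hornerD, hornerN, hornerMn, hornerXn, hornerX) -polyC1 hornerC => /esym e.
by apply/eqP; rewrite -subr_eq0 -e; apply/eqP; ring.
Qed.

Lemma pellpoly_root_neq0 z : root f z -> z != 0.
Proof.
move=> /pellpoly_rootE; apply: contra_eq_neq => ->.
by rewrite !expr0n /= mulr0 subrr sub0r eq_sym oppr_eq0 oner_eq0.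
Qed.

Lemma pellpoly_root_inv z : root f z -> z^-1 = 3 - z - z ^+ k.
Proof.
move=> rz; have z0 := pellpoly_root_neq0 rz.
apply: (mulfI z0); rewrite mulfV // !mulrBr -exprS pellpoly_rootE //; ring.
Qed.

Lemma pellpoly_int : f \is a polyOver Num.int.
Proof.
apply/polyOverP => i; rewrite /pellpoly pellpoly_sum_polyE coefD coefB coef_poly coefX coefC.
have -> : (if (i < k.+1)%N then 1 else 0) + ((i == 1)%:R - (if i == 0 then 2 else 0)) =
    (((i < k.+1)%N : nat)%:Z + (i == 1 : nat)%:Z - (2 * (i == 0))%N%:Z)%:~R :> algC.
  rewrite !rmorphD rmorphN /= addrA; congr (_ + _ - _); first by case: ltnP.
  by case: eqP.
exact: intr_int.
Qed.

Lemma pellpoly_root_Aint z : root f z -> z \in Aint.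
Proof. by move=> rz; apply: root_monic_Aint rz (monic_pellpoly _ k_gt2) pellpoly_int. Qed.

(** The constant coefficient of [f] is -1, so the roots are units. Ratios of roots are then
    integral, and only the derivatives have to be cleared from the determinant. *)
Lemma pellpoly_root_inv_Aint z : root f z -> z^-1 \in Aint.
Proof.
move=> rz; have Az := pellpoly_root_Aint rz.
by rewrite pellpoly_root_inv // !rpredB ?rpredX // ?rpred_nat // Aint_int.
Qed.

Lemma pellpoly_aut (nu : {rmorphism algC -> algC}) : map_poly nu f = f.
Proof.
rewrite /pellpoly rmorphD rmorph_sum rmorphB /= map_polyX map_polyC [X in X%:P](rmorph_nat nu 2).
by rewrite (eq_bigr (fun i : 'I_k.+1 => 'X^i)) // => i _; rewrite map_polyXn.
Qed.

Lemma pellpoly_root_aut (nu : {rmorphism algC -> algC}) z : root f z -> root f (nu z).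
Proof. by move=> rz; rewrite -[f](pellpoly_aut nu) fmorph_root. Qed.

Lemma pellpoly_deriv_aut (nu : {rmorphism algC -> algC}) z : nu f^`().[z] = f^`().[nu z].
Proof. by rewrite -horner_map -deriv_map pellpoly_aut. Qed.

Lemma pellpoly_deriv_Aint z : root f z -> f^`().[z] \in Aint.
Proof.
move=> rz; have Az := pellpoly_root_Aint rz.
rewrite horner_coef rpred_sum // => i _; rewrite rpredM ?rpredX //.
by rewrite Aint_Cint // (polyOverP _) // polyOver_deriv // pellpoly_int.
Qed.

(* Norms valued in the ordered field [algR], where [lra] and [nra] apply. *)
Definition nm (z : algC) : algR := in_algR (normr_real z).

Lemma nm_ge0 z : 0 <= nm z. Proof. exact: normr_ge0. Qed.
Lemma nm_gt0 z : (0 < nm z) = (z != 0). Proof. exact: normr_gt0. Qed.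
Lemma nmM z w : nm (z * w) = nm z * nm w. Proof. exact/val_inj/normrM. Qed.
Lemma nmX z n : nm (z ^+ n) = nm z ^+ n.
Proof. by apply/val_inj; rewrite /= normrX [RHS](rmorphXn algRval). Qed.
Lemma nmV z : nm z^-1 = (nm z)^-1.
Proof. exact/val_inj/normfV. Qed.
Lemma nmN z : nm (- z) = nm z. Proof. exact/val_inj/normrN. Qed.
Lemma nm_nat n : nm n%:R = n%:R.
Proof. by apply/val_inj; rewrite /= normr_nat [RHS](rmorph_nat algRval). Qed.
Lemma nm0 : nm 0 = 0. Proof. exact: nm_nat 0. Qed.
Lemma nm1 : nm 1 = 1. Proof. exact: nm_nat 1. Qed.
Lemma nmD z w : nm (z + w) <= nm z + nm w. Proof. exact: ler_normD. Qed.
Lemma nmB z w : nm (z - w) <= nm z + nm w. Proof. exact: ler_normB. Qed.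

Lemma pellpoly_root_lt2 z : root f z -> `|z| < 2.
Proof.
move=> rz; rewrite -[2](rmorph_nat algRval 2) -[`|z|]/(algRval (nm z)).
suff : nm z < 2 by [].
rewrite ltNge; apply/negP => z2.
have h1 : nm z ^+ k.+1 <= 3 * nm z + nm z ^+ 2 + 1.
  rewrite -nmX pellpoly_rootE //.
  apply: le_trans (nmB _ _) _; rewrite nm1 lerD2r.
  by apply: le_trans (nmB _ _) _; rewrite nmM nm_nat nmX.
have h2 : nm z ^+ 4 <= nm z ^+ k.+1 by apply: ler_weXn2l => //; lra.
have h3 : 2 * nm z <= nm z ^+ 2 by nra.
have h4 : 4 * nm z ^+ 2 <= nm z ^+ 4.
  have -> : nm z ^+ 4 = nm z ^+ 2 * nm z ^+ 2 by ring.
  by apply: ler_wpM2r; [apply: exprn_ge0; exact: nm_ge0 | lra].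
have := le_trans h2 h1; lra.
Qed.

Lemma pellpoly_root_ge z : root f z -> `|z^-1| <= 4.
Proof.
move=> rz; have z0 := pellpoly_root_neq0 rz.
rewrite -[4](rmorph_nat algRval 4) -[`|_|]/(algRval (nm z^-1)).
suff : nm z^-1 <= 4 by [].
have [zl|zg] := lerP 4^-1 (nm z).
  by rewrite nmV invf_ple ?posrE ?nm_gt0.
rewrite pellpoly_root_inv //; apply: le_trans (nmB _ _) _.
have := nmB 3 z; rewrite nmX nm_nat => h.
have : nm z ^+ k <= nm z.
  rewrite -[leRHS]expr1; apply: ler_wiXn2l => //; first exact: nm_ge0.
    by lra.
  by lia.
by lra.
Qed.

Lemma horner_deriv_pellpoly z : f^`().[z] = \sum_(i < k.+1) i%:R * z ^+ i.-1 + 1.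
Proof.
rewrite /pellpoly derivD linear_sum hornerD horner_sum derivB derivX derivC subr0 hornerC.
congr (_ + _); apply: eq_bigr => i _; rewrite /= derivXn hornerMn hornerXn.
by rewrite mulr_natl.
Qed.

Lemma pellpoly_deriv_le z : root f z -> `|f^`().[z]| <= (4 ^ k)%:R.
Proof.
move=> rz.
have z2 := ltW (pellpoly_root_lt2 rz).
rewrite horner_deriv_pellpoly.
apply: le_trans (ler_normD _ _) _.
apply: (@le_trans _ _ ((\sum_(i < k.+1) i * 2 ^ i.-1) + 1)%:R).
  rewrite natrD normr1 lerD2r natr_sum; apply: le_trans (ler_norm_sum _ _ _) _.
  apply: ler_sum => i _; rewrite normrM normr_nat natrM ler_wpM2l // normrX natrX.
  by apply: lerXn2r; rewrite ?nnegrE.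
have e j : (1 + \sum_(i < j.+1) i * 2 ^ i.-1 + 2 ^ j = j * 2 ^ j + 2)%N.
  elim: j => [|j IHj]; first by rewrite big_ord_recr big_ord0.
  rewrite big_ord_recr /= !expnS; set P := (2 ^ j)%N in IHj *; set Q := bigop.body _ _ _ in IHj *; nia.
rewrite ler_nat.
have := e k; have : (k < 2 ^ k)%N by exact: ltn_expl.
have -> : (4 ^ k = 2 ^ k * 2 ^ k)%N by rewrite -expnMn.
nia.
Qed.

(* A double root of [f] satisfies a quadratic equation with real positive roots, but [f^`()] is
   positive on the positive reals. *)
Lemma pellpoly_deriv_neq0 z : root f z -> f^`().[z] != 0.
Proof.
move=> rz; apply/eqP => d0.
have := congr1 (fun p => p^`().[z]) pellpoly_mulXsub1.
rewrite /= derivM hornerD [in LHS]hornerM (rootP rz) mulr0 hornerM d0 mulr0 addr0.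
rewrite !(derivE, hornerD, hornerN, hornerMn, hornerX, hornerXn) -polyC1 !(hornerM, hornerC, hornerX) /= => e.
have e2 : z * (z ^+ k *+ k.+1 + z *+ 2 - 1 *+ 3) = 0.
  by rewrite [X in _ * X](_ : _ = 0) ?mulr0 // e; ring.
have e3 : (k%:R - 1) * z ^+ 2 + (k%:R + 1) = 3 * k%:R * z.
  have : k.+1%:R * z ^+ k.+1 + 2 * z ^+ 2 - 3 * z = 0.
    by rewrite -e2 exprS; ring.
  rewrite pellpoly_rootE // -natr1 => h.
  by apply/eqP; rewrite -subr_eq0 -oppr_eq0 -h; apply/eqP; ring.
have k1 : 0 < k%:R - 1 :> algC by rewrite subr_gt0 ltr1n ltnW.
have zR : z \is Creal.
  have : 2 * (k%:R - 1) * z - 3 * k%:R \is Creal.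
    rewrite realEsqr.
    have -> : (2 * (k%:R - 1) * z - 3 * k%:R) ^+ 2 = 5 * k%:R ^+ 2 + 4.
      have -> : (2 * (k%:R - 1) * z - 3 * k%:R) ^+ 2 =
        4 * (k%:R - 1) * ((k%:R - 1) * z ^+ 2 + (k%:R + 1) - 3 * k%:R * z) +
        9 * k%:R ^+ 2 - 4 * (k%:R - 1) * (k%:R + 1) by ring.
      by rewrite e3; ring.
    by rewrite addr_ge0 // mulr_ge0 // exprn_ge0.
  move=> h; have -> : z = (2 * (k%:R - 1) * z - 3 * k%:R + 3 * k%:R) / (2 * (k%:R - 1)).
    by field; rewrite gt_eqF.
  apply: realM; first by apply: realD => //; apply: realM; apply: realn.
  by rewrite realV; apply: realM; [apply: realn | apply/ger0_real/ltW].
have z0 : 0 < z.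
  have k0 : 0 < 3 * k%:R :> algC by rewrite mulr_gt0 // ltr0n; lia.
  rewrite -(pmulr_rgt0 _ k0) -e3; apply: ltr_wpDl.
    by apply: mulr_ge0; [exact: ltW k1 | rewrite -realEsqr].
  by rewrite addr_gt0 // ltr0n; lia.
have := d0; rewrite horner_deriv_pellpoly => /eqP; rewrite gt_eqF //.
apply: ltr_wpDl => //; apply: sumr_ge0 => i _.
by rewrite mulr_ge0 // exprn_ge0 // ltW.
Qed.
End PellPolynomial.

(** * Lower bound for the interpolation determinant *)

Section InterpolationLower.
Variables (k : nat) (k_gt2 : (2 < k)%N).
Local Notation f := (pellpoly algC k).
Variables (K L T S q p t X : nat).
Variables (g : 'I_(K * L) -> 'I_K * 'I_L) (h : 'I_(K * L) -> 'I_(T + L) * 'I_S).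

Definition beta_ (z w : algC) := (z / w) ^+ p.
Definition gamma_ (z w : algC) := - (f^`().[z] / f^`().[w]) * (w / z) ^+ t.

(* The entries of the interpolation matrix, with the denominators [f'(w)] cleared. *)
Definition int_entry (z w : algC) (i j : 'I_(K * L)) : algC :=
  'C((h j).1 + (h j).2 * q, (g i).1)%:R *
  ((z / w) ^+ (p * (h j).1 * (g i).2) * (w / z) ^+ (t * (h j).2 * (g i).2)) *
  ((-1) ^+ ((h j).2 * (g i).2) *
   (f^`().[z] ^+ ((h j).2 * (g i).2) * f^`().[w] ^+ ((h j).2 * (L - (g i).2)))).

Let D z w := \det (\matrix_(i, j) int_entry z w i j).
Let H := (X ^ K * 2 ^ (3 * L * (p * (T + L) + t * S) + 2 * k * L * S))%N.

(** An automorphism only replaces [(z, w)] by another pair of roots, so the determinant has at most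
    [k * k] conjugates, whatever the degree of the splitting field. *)
Lemma int_entry_aut (nu : {rmorphism algC -> algC}) z w : nu (D z w) = D (nu z) (nu w).
Proof.
rewrite /D -det_map_mx; congr (\det _); apply/matrixP => i j; rewrite !mxE /int_entry.
by rewrite !(rmorphM, rmorphXn, rmorph_nat, rmorphN, rmorph1, fmorphV) /= !pellpoly_deriv_aut.
Qed.

Lemma int_entry_Aint z w i j : root f z -> root f w -> int_entry z w i j \in Aint.
Proof.
move=> rz rw; have Az := pellpoly_root_Aint k_gt2 rz; have Aw := pellpoly_root_Aint k_gt2 rw.
have AVz := pellpoly_root_inv_Aint k_gt2 rz; have AVw := pellpoly_root_inv_Aint k_gt2 rw.
have Adz := pellpoly_deriv_Aint k_gt2 rz; have Adw := pellpoly_deriv_Aint k_gt2 rw.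
have A1 : 1 \in Aint := Aint1.
by rewrite /int_entry !(rpredM, rpredX, rpredN, rpred_nat).
Qed.

Lemma det_int_entry_Aint z w : root f z -> root f w -> D z w \in Aint.
Proof.
move=> rz rw; rewrite /D /determinant rpred_sum // => s _; rewrite rpredM //.
  by rewrite rpredX // rpredN Aint1.
by rewrite rpred_prod // => i _; rewrite mxE int_entry_Aint.
Qed.

Lemma ratio_le z w : root f z -> root f w -> `|z / w| <= 8.
Proof.
move=> rz rw; rewrite normrM (_ : 8 = 2 * 4); last by rewrite -natrM.
apply: ler_pM => //; first exact/ltW/(pellpoly_root_lt2 k_gt2).
exact: pellpoly_root_ge k_gt2 _ rw.
Qed.

Hypothesis leX : (T + L + S * q <= X)%N.

Lemma norm_int_entry z w i j : root f z -> root f w -> `|int_entry z w i j| <= H%:R.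
Proof.
move=> rz rw.
have i1 := ltnW (ltn_ord (g i).1); have i2 := ltnW (ltn_ord (g i).2).
have j1 := ltnW (ltn_ord (h j).1); have j2 := ltnW (ltn_ord (h j).2).
have X0 : (0 < X)%N by have := ltn_ord (h j).1; lia.
rewrite /int_entry /H !normrM !normrX normr_nat normrN normr1 expr1n mul1r.
have b1 : 'C((h j).1 + (h j).2 * q, (g i).1)%:R <= (X ^ K)%:R :> algC.
  rewrite ler_nat; apply: leq_trans (bin_le_exp _ _) _.
  apply: (@leq_trans (X ^ (g i).1)); last by rewrite leq_pexp2l.
  have [->|n0] := posnP (g i).1; first by rewrite !expn0.
  by rewrite leq_exp2r //; apply: leq_trans leX; rewrite leq_add // leq_mul.
have b2 : `|z / w| ^+ (p * (h j).1 * (g i).2) * `|w / z| ^+ (t * (h j).2 * (g i).2) <=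
    (2 ^ (3 * L * (p * (T + L) + t * S)))%:R.
  apply: (@le_trans _ _ (8 ^+ (p * (T + L) * L) * 8 ^+ (t * S * L))).
    apply: ler_pM; rewrite ?exprn_ge0 //.
      apply: (@le_trans _ _ (8 ^+ (p * (h j).1 * (g i).2))).
        by apply: lerXn2r; rewrite ?nnegrE // ratio_le.
      by apply: ler_weXn2l; rewrite ?ler1n // !leq_mul.
    apply: (@le_trans _ _ (8 ^+ (t * (h j).2 * (g i).2))).
      by apply: lerXn2r; rewrite ?nnegrE // ratio_le.
    by apply: ler_weXn2l; rewrite ?ler1n // !leq_mul.
  rewrite -exprD (_ : 8 = 2 ^+ 3); last by rewrite -natrX.
  rewrite -exprM -natrX ler_nat leq_exp2l //; nia.
have b3 : `|f^`().[z]| ^+ ((h j).2 * (g i).2) * `|f^`().[w]| ^+ ((h j).2 * (L - (g i).2)) <=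
    (2 ^ (2 * k * L * S))%:R.
  apply: (@le_trans _ _ ((4 ^ k)%:R ^+ ((h j).2 * (g i).2) * (4 ^ k)%:R ^+ ((h j).2 * (L - (g i).2)))).
    by apply: ler_pM; rewrite ?exprn_ge0 //; apply: lerXn2r; rewrite ?nnegrE //;
       apply: pellpoly_deriv_le.
  rewrite -exprD -mulnDr subnKC // -natrX ler_nat -expnM (_ : 4 = 2 ^ 2)%N // -expnM.
  by rewrite leq_exp2l // -!mulnA [(L * S)%N]mulnC !leq_mul.
rewrite expnD !natrM -mulrA; apply: ler_pM => //.
  by rewrite !mulr_ge0 // exprn_ge0.
by apply: ler_pM => //; rewrite mulr_ge0 // exprn_ge0.
Qed.

Lemma det_int_entryE z w : root f z -> root f w -> D z w =
  \det (\matrix_(i, j) interp_entry (beta_ z w) (gamma_ z w) q (g i).1 (g i).2 (h j).1 (h j).2) *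
  \prod_j f^`().[w] ^+ ((h j).2 * L).
Proof.
move=> rz rw.
have dw := pellpoly_deriv_neq0 k_gt2 rw.
have -> : \prod_j f^`().[w] ^+ ((h j).2 * L) = \det (diag_mx (\row_j f^`().[w] ^+ ((h j).2 * L))).
  by rewrite det_diag; apply: eq_bigr => j _; rewrite mxE.
rewrite -det_mulmx; congr (\det _); apply/matrixP => i j; rewrite mul_mx_diag !mxE.
rewrite /int_entry /interp_entry /beta_ /gamma_ -[in RHS]mulrA -[in LHS]mulrA; congr (_ * _).
have e : ((h j).2 * L = (h j).2 * (g i).2 + (h j).2 * (L - (g i).2))%N.
  by rewrite -mulnDr subnKC // ltnW.
rewrite e exprD -[- (_ / _)]mulN1r !exprMn !exprVn -!exprM !mulnA.
have z0 := pellpoly_root_neq0 rz; have w0 := pellpoly_root_neq0 rw.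
by field; rewrite !expf_neq0.
Qed.

(** Liouville's inequality is applied to the cleared determinant. The exponent [k * k] counts the
    pairs of roots; the first factor pays for the cleared denominators, at most [4 ^ (k * L * S)]
    per column. *)
Lemma interp_det_lower z w : root f z -> root f w ->
  \det (\matrix_(i, j) interp_entry (beta_ z w) (gamma_ z w) q (g i).1 (g i).2 (h j).1 (h j).2) != 0 ->
  1 <= `|\det (\matrix_(i, j) interp_entry (beta_ z w) (gamma_ z w) q (g i).1 (g i).2 (h j).1 (h j).2)| *
   ((2 ^ (2 * k * L * S)) ^ (K * L) * ((K * L)`! * H ^ (K * L)) ^ (k * k))%:R.
Proof.
move=> rz rw; set d := \det _ => d0.
have dw := pellpoly_deriv_neq0 k_gt2 rw.
have D0 : D z w != 0.
  by rewrite det_int_entryE // mulf_neq0 //; apply/prodf_neq0 => j _; rewrite expf_neq0.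
have [r Dr] := closed_field_poly_normal f.
rewrite (monicP (monic_pellpoly algC k_gt2)) scale1r in Dr.
have szr : size r = k.
  by have := size_pellpoly algC k_gt2; rewrite Dr size_prod_XsubC => -[].
have boundD z' w' : root f z' -> root f w' -> `|D z' w'| <= ((K * L)`! * H ^ (K * L))%:R.
  move=> rz' rw'; rewrite natrM natrX.
  have -> (x : algC) : x ^+ (K * L) = \prod_(i < K * L) x by rewrite prodr_const card_ord.
  by apply: norm_det_le => i j; rewrite mxE norm_int_entry.
have D1 : 1 <= ((K * L)`! * H ^ (K * L))%:R :> algC.
  rewrite ler1n muln_gt0 fact_gt0 /=; have [->|n0] := posnP (K * L)%N; first by rewrite expn0.
  have X0 : (0 < X)%N by have := ltn_ord (h (Ordinal n0)).1; lia.
  by rewrite expn_gt0 /H muln_gt0 !expn_gt0 X0.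
have := @liouville (D z w) _ [seq D a b | a <- r, b <- r] (det_int_entry_Aint rz rw) D0 D1.
rewrite size_allpairs szr => /(_ _ _)/le_trans; apply.
- move=> nu; rewrite int_entry_aut; apply: allpairs_f;
    by rewrite -root_prod_XsubC -Dr pellpoly_root_aut.
- by move=> nu; rewrite int_entry_aut; apply: boundD; apply: pellpoly_root_aut.
rewrite det_int_entryE // normrM -/d -mulrA; apply: ler_wpM2l => //.
rewrite [leRHS]natrM [X in _ <= _ * X]natrX; apply: ler_wpM2r; first exact: exprn_ge0.
rewrite natrX normr_prod.
have -> (x : algC) : x ^+ (K * L) = \prod_(i < K * L) x by rewrite prodr_const card_ord.
apply: ler_prod => j _; rewrite normr_ge0 normrX /=.
apply: (@le_trans _ _ ((4 ^ k)%:R ^+ ((h j).2 * L))).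
  by apply: lerXn2r; rewrite ?nnegrE // pellpoly_deriv_le.
rewrite -natrX ler_nat -expnM (_ : 4 = 2 ^ 2)%N // -expnM leq_exp2l //.
by rewrite -!mulnA [(L * S)%N]mulnC !leq_mul // ltnW.
Qed.
End InterpolationLower.

(** The last hypothesis makes the two bounds for a nonzero minor incompatible. As [w] is the
    conjugate of [z], all of [alpha], [beta] and [gamma] lie on the unit circle; [alpha] not being a
    root of unity, the powers of [beta] are distinct, as the zero estimate requires. *)
Lemma two_log_contradiction (k : nat) (z : algC) (K L T S V p q t : nat) (err : algC) :
  let w := z^* in let alpha := z / w in let N := (K * L)%N in
  let X := (T + L + S * q)%N in
  let H := (X ^ K * 2 ^ (3 * L * (p * (T + L) + t * S) + 2 * k * L * S))%N in
  (2 < k)%N -> root (pellpoly algC k) z ->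
  (forall m, (0 < m)%N -> alpha ^+ m != 1) ->
  (0 < p)%N -> (0 < V)%N -> (T <= q)%N -> (K.-1 * L < T * S)%N ->
  `|alpha ^+ p - 1| <= ((4 * L * V)%:R)^-1 ->
  `|alpha ^+ (q * p + t) + (pellpoly algC k)^`().[z] / (pellpoly algC k)^`().[w]| <= err ->
  (2 ^ N * (X ^ K * (S * L)))%:R * err <= 1 ->
  ((2 ^ (2 * k * L * S)) ^ N * (N`! * H ^ N) ^ (k * k) *
    (N`! * (2 * ((4 * V) ^ K * 4 ^ (X %/ V).+1)) ^ N) < 2 ^ 'C(N, 2))%N ->
  False.
Proof.
move=> w alpha N X H k2 rz tors p0 V0 Tq KLTS bV Lam err1.
have rw : root (pellpoly algC k) w by apply: pellpoly_root_aut.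
have z0 := pellpoly_root_neq0 rz; have w0 := pellpoly_root_neq0 rw.
have dz0 := pellpoly_deriv_neq0 k2 rz; have dw0 := pellpoly_deriv_neq0 k2 rw.
have alpha1 : `|alpha| = 1 by rewrite normf_div norm_conjC divff // normr_eq0.
have alpha0 : alpha != 0 by rewrite -normr_eq0 alpha1 oner_eq0.
have beta1 : `|beta_ p z w| = 1 by rewrite normrX alpha1 expr1n.
have gamma1 : `|gamma_ k t z w| = 1.
  rewrite /gamma_ normrM normrN normrX !normf_div norm_conjC divff ?normr_eq0 // expr1n mulr1.
  by rewrite -(pellpoly_deriv_aut k Num.conj) norm_conjC divff // normr_eq0.
have wz : w / z = alpha^-1 by rewrite invf_div.
have gb : `|gamma_ k t z w - beta_ p z w ^+ q| <= err.
  apply: le_trans Lam; rewrite -[leRHS]mul1r -(expr1n _ t) -{1}(invr1 _) -alpha1 -normfV -normrX -normrM.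
  rewrite -normrN opprB /gamma_ /beta_ wz -exprM mulrDr -[(z / w)]/alpha.
  have -> : alpha^-1 ^+ t * alpha ^+ (q * p + t) = alpha ^+ (p * q).
    by rewrite addnC exprD mulrA -exprMn mulVf // expr1n mul1r mulnC.
  by rewrite mulNr opprK [_ / _ * _]mulrC lexx.
have injb : {in gtn L &, injective (fun i => beta_ p z w ^+ i)}.
  move=> i j _ _ /=; rewrite /beta_ -[z / w]/alpha -!exprM.
  wlog ij : i j / (i <= j)%N => [hw|].
    by have [ij|/ltnW ji] := leqP i j; [apply: hw | move/esym/hw => ->].
  move=> e; apply/eqP; rewrite eqn_leq ij /= leqNgt; apply/negP => ij'.
  have : alpha ^+ (p * (j - i)) = 1.
    apply: (mulfI (expf_neq0 (p * i) alpha0)).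
    by rewrite mulr1 -exprD -mulnDr subnKC.
  by apply/eqP/tors; rewrite muln_gt0 p0 subn_gt0.
have beta0 : beta_ p z w != 0 by rewrite -normr_eq0 beta1 oner_eq0.
have gamma0 : gamma_ k t z w != 0 by rewrite -normr_eq0 gamma1 oner_eq0.
have [g [h d0]] := nonzero_minor beta0 gamma0 injb Tq KLTS.
have up := interp_det_upper g h V0 beta1 gamma1 bV gb (leqnn _) err1.
have low := interp_det_lower k2 (leqnn X) rz rw d0.
rewrite ltnNge => /negP; apply; rewrite -(ler_nat algC).
move: up low; rewrite -/N -/X -/H; set d := `|_|; set A := (_ ^ N * _ ^ (k * k))%N.
set B := (_`! * _)%N => up low.
rewrite [leRHS]natrM; apply: le_trans (ler_wpM2l (ler0n _ A) up).
by rewrite mulrCA -[leLHS]mulr1; apply: ler_wpM2l => //; rewrite mulrC.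
Qed.

(** * The roots of largest modulus *)

Section DominantRoot.
Variable k : nat.
Hypotheses (k_gt2 : (2 < k)%N) (k_odd : odd k).
Local Notation f := (pellpoly algC k).

(** The parity of [k] enters here: [z ^ k.+1] is nonnegative for real [z], whereas [3 z - z^2 - 1]
    is negative for [z <= 0]. *)
Lemma pellpoly_real_root_gt0 z : root f z -> z \is Creal -> 0 < z.
Proof.
move=> rz zR; rewrite real_ltNge ?rpred0 //; apply/negP => z0.
have : 0 <= z ^+ k.+1 by rewrite real_exprn_even_ge0 //= k_odd.
rewrite (pellpoly_rootE rz) real_leNgt ?rpred0 //; last first.
  by rewrite !rpredB ?rpredM ?rpredX ?rpred1 // realn.
apply/negP/negPn; rewrite -addrA -opprD ltr_wnDl //; first by rewrite pmulr_rle0.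
by rewrite oppr_lt0 ltr_wpDl // -realEsqr.
Qed.

(* In the closed unit disc the triangle inequality is an equality in [3 z = 1 + z^2 + z^(k+1)]. *)
Lemma pellpoly_small_root z : root f z -> `|z| <= 1 -> z = `|z|.
Proof.
move=> rz z1.
have ez : 3 * z = 1 + z ^+ 2 + z ^+ k.+1 by rewrite (pellpoly_rootE rz); ring.
have eqN : `|1 + z ^+ 2 + z ^+ k.+1| = 1 + `|z| ^+ 2 + `|z| ^+ k.+1.
  have le1 : `|1 + z ^+ 2 + z ^+ k.+1| <= 1 + `|z| ^+ 2 + `|z| ^+ k.+1.
    apply: le_trans (ler_normD _ _) _; rewrite normrX lerD2r.
    by apply: le_trans (ler_normD _ _) _; rewrite normr1 normrX.
  (* Multiplying this by [|z| - 1 <= 0] gives [1 + |z|^2 + |z|^(k+1) <= 3 |z|], the reverse of the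
     triangle inequality. *)
  have ge1 : 1 <= `|z| + \sum_(i < k) `|z| ^+ i.+1.
    have : z + \sum_(i < k) z ^+ i.+1 = 1.
      have /rootP := rz; rewrite horner_pellpoly big_ord_recl expr0 => h.
      by apply/eqP; rewrite -subr_eq0 -[X in _ == X]h; apply/eqP; rewrite /bump /=; ring.
    move=> e1; have := ler_normD z (\sum_(i < k) z ^+ i.+1); rewrite e1 normr1.
    move=> /le_trans; apply; rewrite lerD2l.
    apply: le_trans (ler_norm_sum _ _ _) _.
    by apply: ler_sum => i _; rewrite normrX.
  apply/eqP; rewrite eq_le le1 /= -ez normrM normr_nat.
  have : (`|z| - 1) * (`|z| + \sum_(i < k) `|z| ^+ i.+1 - 1) <= 0.
    by rewrite mulr_le0_ge0 // ?subr_le0 // subr_ge0.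
  have -> : (`|z| - 1) * (`|z| + \sum_(i < k) `|z| ^+ i.+1 - 1) =
     1 + `|z| ^+ 2 + `|z| ^+ k.+1 - 3 * `|z|.
    have := subrX1 `|z| k.+1; rewrite big_ord_recl expr0 /bump /= => h.
    set s := \sum_(i < k) _ in h *.
    have -> : `|z| ^+ k.+1 = `|z| ^+ k.+1 - 1 + 1 by ring.
    by rewrite h; ring.
  by rewrite subr_le0.
have eq2 : `|1 + z ^+ 2| = `|1| + `|z ^+ 2| :> algC.
  apply/eqP; rewrite eq_le ler_normD /=.
  rewrite -(lerD2r `|z ^+ k.+1|) normr1 !normrX -eqN -normrX; exact: ler_normD.
have [u _ [e1 e2]] := normCDeq eq2.
rewrite normr1 mul1r in e1; rewrite -e1 mulr1 in e2.
have zR : z \is Creal by rewrite realEsqr e2.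
by rewrite gtr0_norm // pellpoly_real_root_gt0.
Qed.

Lemma pellpoly_root_nonreal z : root f z -> 1 <= `|z| -> z \isn't Creal.
Proof.
move=> rz z1; apply/negP => zR; have z0 := pellpoly_real_root_gt0 rz zR.
rewrite gtr0_norm // in z1.
have /rootP := rz; rewrite horner_pellpoly => /eqP; rewrite gt_eqF //.
have -> : k.+1 = k.-1.+2 by lia.
rewrite !big_ord_recl expr0 /bump /=.
have s0 : 0 <= \sum_(i < k.-1) z ^+ i.+2.
  by apply: sumr_ge0 => i _; rewrite exprn_ge0 // ltW.
have -> : 1 + (z ^+ 1 + \sum_(i < k.-1) z ^+ i.+2) + (z - 2) =
   (z - 1) + (z + \sum_(i < k.-1) z ^+ i.+2) by ring.
by rewrite ltr_wpDl ?subr_ge0 // ltr_wpDr.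
Qed.

(* An automorphism moves [z] into the closed unit disc, where a root is equal to its norm. *)
Lemma pellpoly_root_nontorsion z m : root f z -> 1 <= `|z| -> (0 < m)%N -> (z / z^*) ^+ m != 1.
Proof.
move=> rz z1 m0; apply/eqP => e.
have z0 := pellpoly_root_neq0 rz.
have [nu] := exists_large_conj (pellpoly_root_inv_Aint k_gt2 rz) (invr_neq0 z0).
rewrite fmorphV normfV => h.
have rw := pellpoly_root_aut nu rz.
have rw' := pellpoly_root_aut nu (pellpoly_root_aut Num.conj rz).
have w0 := pellpoly_root_neq0 rw; have w0' := pellpoly_root_neq0 rw'.
have w1 : `|nu z| <= 1 by rewrite -invr_ge1 ?unitfE ?normr_eq0 ?posrE ?normr_gt0.
(* If [z] over its conjugate is a root of unity, the images of both under [nu] have the same norm.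
   Being in the closed disc, each image equals its norm, so they agree and [z] is real. *)
have ee : `|nu z| = `|nu z^*|.
  have := congr1 (fun x => `|nu x|) e.
  rewrite rmorphXn fmorph_div rmorph1 normr1 normrX normf_div => /eqP.
  by rewrite pexpr_eq1 ?divr_ge0 // => /eqP/divr1_eq.
have := pellpoly_root_nonreal rz z1; rewrite CrealE.
suff -> : z^* = z by rewrite eqxx.
apply: (fmorph_inj nu).
by rewrite (pellpoly_small_root rw w1) (pellpoly_small_root rw') -?ee.
Qed.
End DominantRoot.

Lemma expr_near1_le (t : algC) (e : algR) (n : nat) :
  0 <= e -> nm (t - 1) <= e -> 2 * n%:R * e <= 1 -> nm (t ^+ n - 1) <= 2 * n%:R * e.
Proof.
move=> e0 te; elim: n => [|n IHn] ne; first by rewrite expr0 subrr nm0 mulr0 mul0r.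
have ne' : 2 * n%:R * e <= 1 by move: ne; rewrite -natr1; nra.
have -> : t ^+ n.+1 - 1 = t * (t ^+ n - 1) + (t - 1) by rewrite exprS; ring.
have t1 : nm t <= 1 + e.
  have := nmD (t - 1) 1; rewrite subrK nm1; lra.
apply: le_trans (nmD _ _) _; rewrite nmM.
have h := IHn ne'.
have := nm_ge0 (t ^+ n - 1); have := nm_ge0 t.
rewrite -natr1 in ne *.
have n0 : 0 <= n%:R :> algR by [].
nra.
Qed.

Section Gap.
Variable k : nat.
Hypotheses (k_gt6 : (6 < k)%N).
Local Notation f := (pellpoly algC k).

(* If [w / z] is close to 1, then the sum of its first [k] powers is close to [k], whereas the
   equations of [z] and [w] bound that sum by 3. *)
Lemma root_separation z w : root f z -> root f w -> z != w ->
  1 <= nm z -> 2^-1 <= nm w -> (4 * k)%:R^-1 <= nm (w - z).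
Proof.
move=> rz rw zw z1 w2; rewrite leNgt; apply/negP => close.
have k2 : (2 < k)%N by lia.
have z0 := pellpoly_root_neq0 rz; have w0 := pellpoly_root_neq0 rw.
have k0 : 0 < (4 * k)%:R :> algR by rewrite ltr0n; lia.
pose e : algR := (4 * k)%:R^-1; pose t := w / z.
have e0 : 0 < e by rewrite invr_gt0.
have te : nm (t - 1) <= e.
  have -> : t - 1 = (w - z) / z by rewrite /t; field.
  rewrite nmM nmV; apply: le_trans (ltW close).
  by rewrite ler_piMr ?nm_ge0 // invf_le1 // (lt_le_trans _ z1).
pose s := \sum_(i < k) t ^+ i.
have zk u : root f u -> u ^+ k = 3 - u - u^-1.
  by move=> ru; rewrite (pellpoly_root_inv ru); ring.
have e1 : z ^+ k.-1 * s = (z * w)^-1 - 1.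
  have t1 : t - 1 != 0.
    by rewrite subr_eq0 /t; apply: contra zw => /eqP/divr1_eq ->.
  apply: (mulfI (mulf_neq0 z0 t1)).
  have -> : z * (t - 1) * (z ^+ k.-1 * s) = z ^+ k.-1.+1 * ((t - 1) * s) by rewrite exprS; ring.
  rewrite prednK; last exact: ltnW (ltnW k2).
  rewrite -(subrX1 t k).
  rewrite mulrBr mulr1 /t -exprMn mulrCA divff // mulr1 !zk //.
  by field; rewrite ?z0 ?w0.
have s_ge : k%:R / 2 <= nm s.
  have : nm (k%:R - s) <= k%:R / 2.
    have -> : k%:R - s = \sum_(i < k) (1 - t ^+ i).
      by rewrite sumrB sumr_const card_ord.
    apply: (@le_trans _ _ (\sum_(i < k) 2^-1)); last by rewrite sumr_const card_ord mulr_natl lexx.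
    have tri (F : 'I_k -> algC) : nm (\sum_i F i) <= \sum_i nm (F i).
      elim/big_rec2: _ => [|i x y _ h]; first by rewrite nm0.
      by apply: le_trans (nmD _ _) _; rewrite lerD2l.
    apply: le_trans (tri _) _; apply: ler_sum => i _; rewrite -nmN opprB.
    have le2 : 2 * i%:R * e <= 2^-1.
      rewrite /e ler_pdivrMr // natrM.
      have : (i%:R : algR) <= k%:R by rewrite ler_nat ltnW.
      lra.
    by apply: le_trans (le2); apply: expr_near1_le; [exact: ltW| exact: te | lra].
  have := nmD (k%:R - s) s; rewrite subrK nm_nat; lra.
have := congr1 nm e1; rewrite nmM nmX => e2.
have zk1 : 1 <= nm z ^+ k.-1 by rewrite exprn_ege1.
have up : nm ((z * w)^-1 - 1) <= 3.
  apply: le_trans (nmB _ _) _; rewrite nmV nmM nm1.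
  have : (nm z * nm w)^-1 <= 2; last by lra.
  by rewrite invf_ple ?posrE ?mulr_gt0 ?nm_gt0 //; nra.
(* [k / 2 <= |s| <= 3] is impossible from [k = 7] on. *)
have k7 : 7 <= k%:R :> algR by rewrite ler_nat.
have := nm_ge0 s; nra.
Qed.

Definition re z : algR := in_algR (Creal_Re z).

Lemma re_le z : `|re z| <= nm z.
Proof. exact: (leif_normC_Re_Creal z).1. Qed.

Lemma addC_conj z : z + z^* = 2 * (re z : algC).
Proof. by rewrite /= ReE; field. Qed.

Lemma mulC_conj z : z * z^* = (nm z : algC) ^+ 2.
Proof. by rewrite /= normCK. Qed.

(** Both sides are the squared norm of [z ^ k.+1 = 3 z - z^2 - 1]. *)
Lemma norm_rootE z : root f z ->
  (nm z ^+ 2) ^+ k.+1 = (nm z ^+ 2) ^+ 2 + 7 * nm z ^+ 2 + 1 + 4 * re z ^+ 2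
     - 6 * re z * (nm z ^+ 2 + 1).
Proof.
move=> rz; apply: val_inj.
rewrite /= !(rmorphD, rmorphN, rmorphB, rmorphM, rmorphXn, rmorph_nat, rmorph1) /=.
rewrite -[`|z|]/(nm z : algC) -mulC_conj exprMn -rmorphXn /= (pellpoly_rootE rz).
rewrite !(rmorphB, rmorphM, rmorphXn, rmorph_nat, rmorph1) /=.
have -> : 'Re z = (z + z^*) / 2 by rewrite ReE.
by rewrite -!expr2 normCK; field.
Qed.

(* By [norm_rootE] the norm of a root determines its real part, so a root of almost the same norm
   as [z] is close to [z] or [z^*]. *)
Lemma root_gap z w : root f z -> root f w -> 1 <= nm z -> nm w <= nm z ->
  z != w -> z^* != w -> nm w <= (1 - ((32 * k) ^ 3)%:R^-1) * nm z.
Proof.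
move=> rz rw z1 wz nzw nzw'; rewrite leNgt; apply/negP => close.
have k2 : (2 < k)%N by lia.
have rz' : root f z^* by apply: pellpoly_root_aut.
have nz' : nm z^* = nm z by apply: val_inj; rewrite /= norm_conjC.
have z2 : nm z < 2 by have := pellpoly_root_lt2 k2 rz; rewrite -[2](rmorph_nat algRval 2).
pose kap : algR := k%:R; have k7 : 7 <= kap by rewrite ler_nat.
pose eta : algR := kap^-1.
have eta_gt0 : 0 < eta by rewrite invr_gt0; lra.
have ke : kap * eta = 1 by rewrite divff // gt_eqF //; lra.
have eta7 : 7 * eta <= 1.
  have : 7 * eta <= kap * eta by rewrite ler_pM2r.
  lra.
(* The cube balances the end of the proof: the separations make the product of the distances from
   [w] to [z] and to its conjugate at least [eta^2 / 16], the norms make it at most [197 kap * 8 m],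
   and [16 * 197 * 8 < 32^3]. *)
pose m : algR := (eta / 32) ^+ 3.
have mE : ((32 * k) ^ 3)%:R^-1 = m.
  by rewrite natrX natrM -exprVn invfM mulrC.
rewrite mE in close.
have m0 : 0 < m by rewrite exprn_gt0 // divr_gt0.
have m1 : m <= 4^-1.
  have : eta / 32 <= 4^-1 by lra.
  apply: le_trans; rewrite -[leRHS]expr1; apply: ler_wiXn2l => //; lra.
have w2 : 2^-1 <= nm w by nra.
have sep1 := root_separation rz rw nzw z1 w2.
have sep2 := root_separation rz' rw nzw'; rewrite nz' in sep2; have {}sep2 := sep2 z1 w2.
have iE : (4 * k)%:R^-1 = eta / 4 by rewrite natrM invfM mulrC.
rewrite iE in sep1 sep2.
set P := nm z ^+ 2; set R := nm w ^+ 2.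
have P4 : P <= 4 by rewrite /P; nra.
have P1 : 1 <= P by rewrite /P; nra.
have R0 : 0 <= R by rewrite exprn_ge0 ?nm_ge0.
have RP : R <= P by rewrite /R /P; have := nm_ge0 w; nra.
pose Del := P - R.
have Del0 : 0 <= Del by rewrite subr_ge0.
have Delm : Del <= 8 * m by rewrite /Del /P /R; have := nm_ge0 w; nra.
have xz := re_le z; have xw := re_le w.
set x := re z in xz *; set y := re w in xw *.
have /andP[xz1 xz2] : - nm z <= x <= nm z by rewrite -ler_norml.
have /andP[xw1 xw2] : - nm w <= y <= nm w by rewrite -ler_norml.
have Ez := norm_rootE rz; have Ew := norm_rootE rw.
rewrite -/P -/x in Ez; rewrite -/R -/y in Ew.
have Pk : P ^+ k <= 121.
  apply: (@le_trans _ _ (P ^+ k.+1)); first by rewrite ler_weXn2l.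
  by rewrite Ez; nra.
have P0 : 0 <= P by lra.
have pw0 : R ^+ k.+1 <= P ^+ k.+1 by apply: lerXn2r.
have pw : P ^+ k.+1 - R ^+ k.+1 <= 121 * (kap + 1) * Del.
  rewrite subrXX mulrC; apply: ler_wpM2r => //.
  apply: (@le_trans _ _ (\sum_(i < k.+1) P ^+ k)).
    apply: ler_sum => i _ /=.
    have ik : (i <= k)%N by rewrite -ltnS.
    rewrite -[X in P ^+ X](subnK ik) exprD; apply: ler_wpM2l; last exact: lerXn2r.
    by rewrite exprn_ge0 // (le_trans _ P1).
  rewrite sumr_const card_ord -[leLHS]mulr_natl -[k.+1%:R]natr1 -/kap [leLHS]mulrC; apply: ler_wpM2r => //; lra.
(* The difference of the two norm equations factors. The second factor is at least 3, so [x - y] is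
   at most of the order of [kap * Del]. *)
have eqD : (x - y) * (6 * (P + 1) - 4 * (x + y)) =
   Del * (P + R + 7 - 6 * y) - (P ^+ k.+1 - R ^+ k.+1) by rewrite Ez Ew /Del; ring.
have sqP : 2 * nm z - 1 <= P.
  have := sqr_ge0 (nm z - 1); rewrite sqrrB -/P; lra.
have c3 : 3 <= 6 * (P + 1) - 4 * (x + y) by lra.
have b1 : -4 <= P + R + 7 - 6 * y by lra.
have b2 : P + R + 7 - 6 * y <= 27 by lra.
have D1 : x - y <= 49 * kap * Del.
  have [d|d] := lerP (x - y) 0; first by apply: le_trans d _; rewrite !mulr_ge0 //; lra.
  have h1 : (x - y) * 3 <= (x - y) * (6 * (P + 1) - 4 * (x + y)) by apply: ler_wpM2l => //; exact: ltW.
  have h2 : Del * (P + R + 7 - 6 * y) <= Del * 27 by apply: ler_wpM2l.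
  have h3 : 7 * Del <= kap * Del by apply: ler_wpM2r.
  rewrite eqD in h1; rewrite -mulrA; lra.
have D2 : - (49 * kap * Del) <= x - y.
  have [d|d] := lerP 0 (x - y); first by apply: le_trans _ d; rewrite oppr_le0 !mulr_ge0 //; lra.
  have h1 : (x - y) * (6 * (P + 1) - 4 * (x + y)) <= (x - y) * 3 by apply: ler_wnM2l => //; exact: ltW.
  have h2 : Del * (-4) <= Del * (P + R + 7 - 6 * y) by apply: ler_wpM2l.
  have h3 : 7 * Del <= kap * Del by apply: ler_wpM2r.
  rewrite eqD in h1; rewrite -mulrA; rewrite -mulrA mulrDl mul1r in pw; lra.
have Dxy : nm ((y : algC) - (x : algC)) <= 49 * kap * Del.
  have -> : nm ((y : algC) - (x : algC)) = `|x - y| by rewrite distrC; apply: val_inj.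
  by rewrite ler_norml D1 D2.
(* [z] and its conjugate are the roots of [X^2 - 2 x X + P], and [w] is a root of [X^2 - 2 y X + R];
   evaluating the first at [w] leaves the differences of the coefficients. *)
have prod : (w - z) * (w - z^*) = 2 * ((y : algC) - (x : algC)) * w + (Del : algC).
  have -> : (w - z) * (w - z^*) = (w + w^*) * w - (z + z^*) * w + (z * z^* - w * w^*) by ring.
  have -> : (Del : algC) = (nm z : algC) ^+ 2 - (nm w : algC) ^+ 2.
    by rewrite (rmorphB algRval) !(rmorphXn algRval).
  by rewrite !addC_conj !mulC_conj -/x -/y; ring.
have := congr1 nm prod; rewrite nmM => prod'.
have up : nm (2 * ((y : algC) - (x : algC)) * w + (Del : algC)) <= 197 * kap * Del.
  apply: le_trans (nmD _ _) _; rewrite !nmM nm_nat.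
  have -> : nm Del = Del by apply: val_inj; rewrite /= ger0_norm.
  have h3 : 7 * Del <= kap * Del by apply: ler_wpM2r.
  have h4 := nm_ge0 ((y : algC) - (x : algC)).
  have h5 : 2 * nm ((y : algC) - (x : algC)) * nm w <= 2 * nm ((y : algC) - (x : algC)) * 2.
    by apply: ler_wpM2l; [exact: mulr_ge0 | exact: ltW (le_lt_trans wz z2)].
  rewrite -mulrA in Dxy; rewrite -mulrA; lra.
have low : (eta / 4) ^+ 2 <= nm (w - z) * nm (w - z^*).
  have eta4 : 0 <= eta / 4 by rewrite divr_ge0 // ltW.
  by rewrite expr2; apply: ler_pM.
rewrite prod' in low.
have Delk : kap * Del <= kap * (8 * m) by apply: ler_wpM2l => //; lra.
have e16 : (eta / 4) ^+ 2 = eta ^+ 2 / 16 by field.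
rewrite e16 -mulrA in low up *.
have : eta ^+ 2 <= 16 * 197 * kap * (8 * m) by lra.
rewrite /m; have -> : 16 * 197 * kap * (8 * (eta / 32) ^+ 3) = eta ^+ 2 * (kap * eta) * (197 / 256) by field.
rewrite ke; have := exprn_gt0 2 eta_gt0; lra.
Qed.
End Gap.

(** * Lagrange interpolation at simple roots *)

Section Lagrange.
Variables (F : fieldType) (p : {poly F}) (r : seq F) (k : nat).
Hypotheses (Dp : p = \prod_(x <- r) ('X - x%:P)) (ur : uniq r) (szr : size r = k).
Let q x := p %/ ('X - x%:P).

Let qE x : x \in r -> p = q x * ('X - x%:P).
Proof. by move=> xr; rewrite divpK // dvdp_XsubCl Dp root_prod_XsubC. Qed.

Let szq x : x \in r -> size (q x) = k.
Proof. by move=> xr; rewrite size_divp ?polyXsubC_eq0 // size_XsubC Dp size_prod_XsubC szr subn1. Qed.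

Let monq x : x \in r -> q x \is monic.
Proof. by move=> xr; rewrite -(monicMr _ (monicXsubC x)) -qE // Dp monic_prod_XsubC. Qed.

Let q_other x y : x \in r -> y \in r -> y != x -> (q x).[y] = 0.
Proof.
move=> xr yr yx; have : p.[y] = 0 by apply/rootP; rewrite Dp root_prod_XsubC.
rewrite (qE xr) hornerM hornerXsubC => /eqP; rewrite mulf_eq0 subr_eq0 (negPf yx) orbF.
by move/eqP.
Qed.

Let q_self x : x \in r -> (q x).[x] = p^`().[x].
Proof.
move=> xr; rewrite [p in RHS](qE xr) derivM derivXsubC mulr1 hornerD hornerM hornerXsubC.
by rewrite subrr mulr0 add0r.
Qed.

(** Interpolation of [X^m] at the [k] roots reproduces it; the claim compares the coefficients of
    [X^(k-1)]. *)
Lemma sum_expr_div_deriv m : {in r, forall x, p^`().[x] != 0} -> (m < k)%N ->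
  \sum_(x <- r) x ^+ m / p^`().[x] = (m == k.-1)%:R.
Proof.
move=> dp mk.
pose Q := \sum_(x <- r) (x ^+ m / p^`().[x]) *: q x - 'X^m.
have szQ : (size Q <= k)%N.
  apply: leq_trans (size_polyD _ _) _; rewrite geq_max size_polyN size_polyXn mk andbT.
  rewrite big_seq; apply: leq_trans (size_sum _ _ _) _; apply/bigmax_leqP_seq => x _ xr.
  by apply: leq_trans (size_scale_leq _ _) _; rewrite szq.
have Q0 : Q = 0.
  apply: (roots_geq_poly_eq0 (rs := r)); rewrite ?szr //.
  apply/allP => y yr; rewrite /root hornerD hornerN hornerXn horner_sum.
  rewrite (bigD1_seq y) //= big_seq_cond big1 ?addr0 => [|x /andP[xr xy]].
    by rewrite hornerZ q_self // divfK ?subrr // dp.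
  by rewrite hornerZ q_other ?mulr0 // eq_sym.
have := congr1 (fun P : {poly F} => P`_k.-1) Q0.
rewrite coef0 coefB coefXn coef_sum => /eqP; rewrite subr_eq0 eq_sym => /eqP h.
rewrite [m == _]eq_sym h [LHS]big_seq [RHS]big_seq; apply: eq_bigr => x xr.
have := monq xr; rewrite monicE /lead_coef szq // coefZ => /eqP ->; rewrite mulr1 //.
Qed.
End Lagrange.

(* Lagrange's form of the sequence, dominated by the roots [z] and [z^*] of maximal norm. *)
Section Lambda.
Variable k : nat.
Hypotheses (k_gt6 : (6 < k)%N) (k_odd : odd k).
Local Notation f := (pellpoly algC k).

Let k_gt2 : (2 < k)%N. Proof. by lia. Qed.

Lemma pellpoly_roots : exists r : seq algC,
  [/\ f = \prod_(x <- r) ('X - x%:P), uniq r, size r = k & forall x, (x \in r) = root f x].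
Proof.
have [r Dr] := closed_field_poly_normal f.
rewrite (monicP (monic_pellpoly algC k_gt2)) scale1r in Dr.
have mr x : (x \in r) = root f x by rewrite Dr root_prod_XsubC.
exists r; split => //.
  apply: (uniq_roots_deriv Dr) => x; rewrite mr; exact: pellpoly_deriv_neq0.
by have := size_pellpoly algC k_gt2; rewrite Dr size_prod_XsubC => -[].
Qed.

Definition pell_rec (U : nat -> algC) :=
  forall j, \sum_(i < k.+1) U (j + i)%N + (U j.+1 - 2 * U j) = 0.

Lemma pell_rec_unique U V : pell_rec U -> pell_rec V ->
  (forall j, (j < k)%N -> U j = V j) -> U =1 V.
Proof.
move=> rU rV e j; elim/ltn_ind: j => j IH.
have [jk|kj] := ltnP j k; first exact: e.
have hU := rU (j - k)%N; have hV := rV (j - k)%N.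
rewrite !big_ord_recr /= subnK // in hU hV.
have es : \sum_(i < k) U (j - k + i)%N = \sum_(i < k) V (j - k + i)%N.
  by apply: eq_bigr => i _; apply: IH; have := ltn_ord i; lia.
rewrite es !(IH (j - k)%N, IH (j - k).+1) in hU; try lia.
by have /eqP := etrans hU (esym hV); rewrite (inj_eq (addIr _)) (inj_eq (addrI _)) => /eqP.
Qed.

Lemma pell_sum_roots (r : seq algC) (U : nat -> algC) :
  f = \prod_(x <- r) ('X - x%:P) -> uniq r -> size r = k -> pell_rec U ->
  (forall j, (j < k)%N -> U j = (j == k.-1)%:R) ->
  forall n, U n = \sum_(x <- r) x ^+ n / f^`().[x].
Proof.
move=> Dr ur szr recU initU.
have mr x : (x \in r) = root f x by rewrite Dr root_prod_XsubC.
apply: pell_rec_unique => // [j|j jk]; last first.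
  by rewrite initU // (sum_expr_div_deriv Dr ur szr) // => x; rewrite mr; exact: pellpoly_deriv_neq0.
rewrite exchange_big /= mulr_sumr -sumrB -big_split /= big_seq big1 // => x.
rewrite mr => /rootP; rewrite horner_pellpoly => fx.
have -> : \sum_(i < k.+1) x ^+ (j + i) / f^`().[x] = x ^+ j / f^`().[x] * \sum_(i < k.+1) x ^+ i.
  by rewrite mulr_sumr; apply: eq_bigr => i _; rewrite exprD mulrAC.
by rewrite exprS -[RHS](mulr0 (x ^+ j / f^`().[x])) -[X in _ = _ * X]fx; ring.
Qed.

Lemma deriv_root_ge z : root f z -> 1 <= `|f^`().[z]| * (4 ^ (k * k))%:R.
Proof.
move=> rz; have [r [Dr ur szr mr]] := pellpoly_roots.
have := @liouville f^`().[z] (4 ^ k)%:R [seq f^`().[x] | x <- r].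
rewrite size_map szr -natrX -expnM; apply.
- exact: pellpoly_deriv_Aint.
- exact: pellpoly_deriv_neq0.
- by rewrite ler1n expn_gt0.
- by move=> nu; rewrite pellpoly_deriv_aut; apply: map_f; rewrite mr pellpoly_root_aut.
- by move=> nu; rewrite pellpoly_deriv_aut; apply: pellpoly_deriv_le => //; apply: pellpoly_root_aut.
Qed.

Lemma exists_max_root : exists z, [/\ root f z, 1 <= `|z| & forall w, root f w -> `|w| <= `|z|].
Proof.
have [r [Dr ur szr mr]] := pellpoly_roots.
have maxP (s : seq algC) : s != [::] -> exists2 z, z \in s & {in s, forall w, `|w| <= `|z|}.
  elim: s => // a [|b s] IHs _.
    by exists a; [rewrite inE eqxx|move=> w; rewrite inE => /eqP ->].
  have [//|z zs zmax] := IHs.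
  have [az|/ltW za] := real_leP (normr_real a) (normr_real z).
    exists z; [by rewrite inE zs orbT|move=> w; rewrite inE => /predU1P[->//|]; exact: zmax].
  exists a; [by rewrite inE eqxx|move=> w; rewrite inE => /predU1P[->//|]].
  by move=> /zmax wz; apply: le_trans wz za.
have [|z zr zmax] := maxP r; first by rewrite -size_eq0 szr; lia.
have rz : root f z by rewrite -mr.
have [nu nu1] := exists_large_conj (pellpoly_root_Aint k_gt2 rz) (pellpoly_root_neq0 rz).
exists z; split => // [|w rw]; last by apply: zmax; rewrite mr.
by apply: le_trans nu1 _; apply: zmax; rewrite mr pellpoly_root_aut.
Qed.

(** [(1 - 1/M)^M <= 1/2], because its product with [(1 + 1/M)^M >= 2] is at most 1. This turns the
    gap between the roots into a power of 2. *)
Lemma pow_1BV_le (C : numFieldType) (M n : nat) : (1 < M)%N ->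
  (1 - M%:R^-1) ^+ n <= ((2 ^ (n %/ M))%:R)^-1 :> C.
Proof.
move=> M1; have M0 : 0 < M%:R :> C by rewrite ltr0n ltnW.
pose y : C := M%:R^-1; have y0 : 0 < y by rewrite invr_gt0.
have y1 : y < 1 by rewrite invf_lt1 // ltr1n.
have th0 : 0 <= 1 - y by rewrite subr_ge0 ltW.
have th1 : 1 - y <= 1 by rewrite gerBl ltW.
have bern m : 1 + m%:R * y <= (1 + y) ^+ m.
  elim: m => [|m IHm]; first by rewrite mul0r addr0.
  have h : 0 <= 1 + y by rewrite addr_ge0 // ltW.
  rewrite exprS; apply: le_trans (ler_wpM2l h IHm).
  have -> : (1 + y) * (1 + m%:R * y) = 1 + m.+1%:R * y + m%:R * y * y by rewrite -natr1; ring.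
  by rewrite lerDl !mulr_ge0 // ltW.
have half : (1 - y) ^+ M <= 2^-1.
  have h2 : 2 <= (1 + y) ^+ M.
    by have := bern M; rewrite /y divff ?gt_eqF // (_ : 1 + 1 = 2) // -natrD.
  have h3 : (1 - y) ^+ M * (1 + y) ^+ M <= 1.
    rewrite -exprMn exprn_ile1 //; first by rewrite mulr_ge0 // addr_ge0 // ltW.
    by rewrite -subr_sqr expr1n gerBl exprn_ge0 // ltW.
  rewrite -[leRHS]mul1r ler_pdivlMr //; apply: le_trans h3.
  by apply: ler_wpM2l; rewrite ?exprn_ge0.
rewrite {1}(divn_eq n M) mulnC exprD exprM natrX -exprVn -[leRHS]mulr1.
apply: ler_pM; rewrite ?exprn_ge0 //; last by rewrite exprn_ile1.
by apply: lerXn2r; rewrite ?nnegrE ?exprn_ge0 ?invr_ge0.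
Qed.

(** At a zero the two dominant terms cancel the rest of the sum; the linear form is that rest, up to
    sign, times [f'(z)] over the [n]th power of the conjugate. The exponent [k * k + 2 * k] collects
    [f'(z)], the number of roots and the inverses of the other derivatives. *)
Lemma pell_zero_Lambda (U : nat -> algC) n : pell_rec U ->
  (forall j, (j < k)%N -> U j = (j == k.-1)%:R) -> U n = 0 ->
  exists z, [/\ root f z, 1 <= `|z| &
   `|(z / z^*) ^+ n + f^`().[z] / f^`().[z^*]| <=
     (4 ^ (k * k + 2 * k))%:R / (2 ^ (n %/ (32 * k) ^ 3))%:R].
Proof.
move=> recU initU Un0.
have [r [Dr ur szr mr]] := pellpoly_roots.
have [z [rz z1 zmax]] := exists_max_root.
exists z; split=> //.
have rw : root f z^* by apply: pellpoly_root_aut.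
have zw : z != z^*.
  by have := pellpoly_root_nonreal k_gt2 k_odd rz z1; rewrite CrealE eq_sym.
have z0 := pellpoly_root_neq0 rz; have w0 := pellpoly_root_neq0 rw.
have dz0 := pellpoly_deriv_neq0 k_gt2 rz; have dw0 := pellpoly_deriv_neq0 k_gt2 rw.
have := pell_sum_roots Dr ur szr recU initU n; rewrite Un0.
rewrite (bigD1_seq z) ?mr //= -big_filter (bigD1_seq z^*) ?filter_uniq //=; last first.
  by rewrite mem_filter mr rw eq_sym zw.
rewrite big_filter_cond; set Rest := \sum_(_ <- r | _) _ => sum0.
pose th : algC := 1 - ((32 * k) ^ 3)%:R^-1.
have M1 : (1 < (32 * k) ^ 3)%N by rewrite (ltn_exp2l 0) //; lia.
have M0 : 0 < ((32 * k) ^ 3)%:R :> algC by rewrite ltr0n ltnW.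
have th0 : 0 <= th by rewrite subr_ge0 invf_le1 // ler1n ltnW.
have gap x : root f x -> x != z -> x != z^* -> `|x| <= th * `|z|.
  move=> rx xz xw; have := @root_gap k k_gt6 z x rz rx z1 (zmax x rx).
  rewrite ![_ == x]eq_sym => /(_ xz xw).
  rewrite -[th * `|z|](_ : algRval ((1 - ((32 * k) ^ 3)%:R^-1) * nm z) = _) //.
  by rewrite rmorphM rmorphB fmorphV rmorph_nat rmorph1.
have zn0 : 0 < `|z| ^+ n by rewrite exprn_gt0 // normr_gt0.
have Restle : `|Rest| <= k%:R * (th ^+ n * `|z| ^+ n * (4 ^ (k * k))%:R).
  apply: (@le_trans _ _ (\sum_(x <- r) (th ^+ n * `|z| ^+ n * (4 ^ (k * k))%:R))); last first.
    by rewrite big_const_seq count_predT szr iter_addr_0 mulr_natl.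
  apply: le_trans (ler_norm_sum _ _ _) _; rewrite big_mkcond [leLHS]big_seq [leRHS]big_seq.
  apply: ler_sum => x; rewrite mr => rx.
  case: ifP => [/andP[xz xw]|_]; last by rewrite !mulr_ge0 ?exprn_ge0.
  rewrite normf_div normrX -exprMn; apply: ler_pM; rewrite ?exprn_ge0 ?invr_ge0 //.
    by apply: lerXn2r; rewrite ?nnegrE ?mulr_ge0 // gap.
  have dx : 0 < `|f^`().[x]| by rewrite normr_gt0 pellpoly_deriv_neq0.
  by rewrite -[leLHS]mul1r ler_pdivrMr // mulrC deriv_root_ge.
have -> : (z / z^*) ^+ n + f^`().[z] / f^`().[z^*] = - (f^`().[z] / z^* ^+ n) * Rest.
  have -> : Rest = - (z ^+ n / f^`().[z] + z^* ^+ n / f^`().[z^*]).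
    by apply/eqP; rewrite -addr_eq0 addrC -addrA -sum0.
  by rewrite expr_div_n; field; rewrite dz0 dw0 expf_neq0.
rewrite normrM normrN normf_div normrX norm_conjC.
apply: (@le_trans _ _ ((4 ^ k)%:R / `|z| ^+ n * (k%:R * (th ^+ n * `|z| ^+ n * (4 ^ (k * k))%:R)))).
  apply: ler_pM => //; first by rewrite divr_ge0 // ltW.
  by apply: ler_wpM2r; rewrite ?invr_ge0 ?exprn_ge0 // pellpoly_deriv_le.
have -> : (4 ^ k)%:R / `|z| ^+ n * (k%:R * (th ^+ n * `|z| ^+ n * (4 ^ (k * k))%:R)) =
   (4 ^ k * k * 4 ^ (k * k))%:R * th ^+ n.
  by rewrite !natrM; field; rewrite gt_eqF.
apply: ler_pM; rewrite ?exprn_ge0 //; last exact: pow_1BV_le.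
rewrite ler_nat mulnAC -expnD mul2n -addnn addnA [(k * k + k)%N]addnC [leqRHS]expnD.
by rewrite leq_mul2l ltnW ?orbT // ltn_expl.
Qed.
End Lambda.

(** * The exponents of the interpolation determinant *)

(** On the circle [(s1 - s2) (s1 + s2) = - (t1 - t2) (t1 + t2)], and [|t1 + t2| <= |s1 + s2|]
    because [s1] and [s2] have the same sign and dominate. *)
Lemma same_arc_le (F : realFieldType) (s1 t1 s2 t2 : F) :
  s1 ^+ 2 + t1 ^+ 2 = 1 -> s2 ^+ 2 + t2 ^+ 2 = 1 ->
  `|t1| <= `|s1| -> `|t2| <= `|s2| -> (0 <= s1) = (0 <= s2) ->
  (s1 - s2) ^+ 2 <= (t1 - t2) ^+ 2.
Proof.
move=> e1 e2 h1 h2 sg.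
have sum_s : `|s1 + s2| = `|s1| + `|s2|.
  have [s1p|s1n] := lerP 0 s1; move: sg.
    by rewrite s1p => /esym s2p; rewrite !ger0_norm ?addr_ge0.
  rewrite leNgt s1n /= => /esym/negbT; rewrite -ltNge => s2n.
  by rewrite !ltr0_norm ?opprD // -oppr_gt0 opprD addr_gt0 ?oppr_gt0.
have le_sq : (t1 + t2) ^+ 2 <= (s1 + s2) ^+ 2.
  rewrite -[leLHS]real_normK ?num_real // -[leRHS]real_normK ?num_real //.
  apply: lerXn2r; rewrite ?nnegrE // sum_s.
  by apply: le_trans (ler_normD _ _) _; apply: lerD.
have s0 : 0 < (s1 + s2) ^+ 2.
  rewrite lt_neqAle sqr_ge0 andbT eq_sym sqrf_eq0 -normr_eq0 sum_s paddr_eq0 // negb_and.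
  apply/orP; left; apply/eqP => z1; move: h1; rewrite z1 normr_le0 => /eqP t0.
  by move/eqP: z1 e1; rewrite normr_eq0 => /eqP ->; rewrite t0 expr0n addr0 => /esym/eqP; rewrite oner_eq0.
rewrite -(ler_pM2r s0) -[leLHS]exprMn.
have -> : (s1 - s2) * (s1 + s2) = - ((t1 - t2) * (t1 + t2)).
  by rewrite -!subr_sqr; apply/eqP; rewrite -subr_eq0; apply/eqP; lra.
by rewrite sqrrN exprMn; apply: ler_wpM2l => //; apply: sqr_ge0.
Qed.

Definition im (z : algC) : algR := in_algR (Creal_Im z).

Lemma norm_re_im z : nm z ^+ 2 = re z ^+ 2 + im z ^+ 2.
Proof.
apply: val_inj; rewrite (rmorphD algRval) !(rmorphXn algRval) /=; exact: normC2_Re_Im.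
Qed.

(* The unit circle is cut into four arcs on each of which one coordinate is 1-Lipschitz in the
   other, and each arc into [3 V] pieces of equal width in that other coordinate. *)
Lemma unit_circle_dirichlet (alpha : algC) (V : nat) : (0 < V)%N -> `|alpha| = 1 ->
  exists2 p, (0 < p <= 12 * V)%N & `|alpha ^+ p - 1| <= V%:R^-1.
Proof.
move=> V0 alpha1.
have nma j : nm (alpha ^+ j) = 1 by apply: val_inj; rewrite /= normrX alpha1 expr1n.
pose x j := re (alpha ^+ j); pose y j := im (alpha ^+ j).
have xy j : x j ^+ 2 + y j ^+ 2 = 1 by rewrite -norm_re_im nma expr1n.
pose flat j := `|y j| <= `|x j|.
pose s j := if flat j then x j else y j; pose t j := if flat j then y j else x j.
have st j : s j ^+ 2 + t j ^+ 2 = 1 by rewrite /s /t; case: ifP => _; rewrite // addrC.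
have ts j : `|t j| <= `|s j|.
  by rewrite /s /t; case: ifP => // /negbT; rewrite /flat -ltNge => /ltW.
pose M := (3 * V)%N; have M0 : 0 < M%:R :> algR by rewrite ltr0n muln_gt0.
have t_lt1 j : -1 < t j < 1.
  have h : `|t j| ^+ 2 < 1.
    have := lerXn2r 2 (normr_ge0 _) (normr_ge0 _) (ts j).
    rewrite !real_normK ?num_real // -(st j) => h.
    have [t0|t0] := eqVneq (t j ^+ 2) 0; last first.
      have : 0 < t j ^+ 2 by rewrite lt_neqAle sqr_ge0 eq_sym t0.
      lra.
    rewrite t0 addr0; have := st j; rewrite t0; lra.
  have : `|t j| < 1 by rewrite -(expr_lt1 (n := 2)).
  by rewrite ltr_norml.
pose v j := (t j + 1) * (M%:R / 2).
have v_bd j : 0 <= v j < M%:R.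
  have /andP[l r] := t_lt1 j; apply/andP; split.
    by rewrite mulr_ge0 ?divr_ge0 //; lra.
  have : (t j + 1) * (M%:R / 2) < 2 * (M%:R / 2) by rewrite ltr_pM2r ?divr_gt0 //; lra.
  by rewrite -/(v j); lra.
have bin j : (Num.truncn (v j) < M)%N.
  have /andP[v0 vM] := v_bd j; have /andP[l _] := truncn_itv v0.
  by rewrite -(ltr_nat algR); apply: le_lt_trans l vM.
pose c (j : 'I_(12 * V).+1) : bool * bool * 'I_M := (flat j, 0 <= s j, Ordinal (bin j)).
have /injectivePn[i [j ij cij]] : ~~ injectiveb c.
  apply/negP => /injectiveP/leq_card; rewrite !card_prod !card_bool !card_ord /M; lia.
wlog ltij : i j ij cij / (i < j)%N => [hw|].
  have := ij; rewrite neq_ltn => /orP[|]; [exact: hw | apply: hw => //].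
  by rewrite eq_sym.
exists (j - i)%N; first by rewrite subn_gt0 ltij /=; have := ltn_ord j; lia.
have -> : `|alpha ^+ (j - i) - 1| = `|alpha ^+ j - alpha ^+ i|.
  have -> : alpha ^+ j - alpha ^+ i = (alpha ^+ (j - i) - 1) * alpha ^+ i.
    by rewrite mulrBl mul1r -exprD subnK // ltnW.
  by rewrite normrM normrX alpha1 expr1n mulr1.
have [fij sij /(congr1 val) /= bij] : [/\ flat i = flat j, (0 <= s i) = (0 <= s j) &
   Ordinal (bin i) = Ordinal (bin j)].
  by case: cij => -> -> e; split => //; apply: val_inj.
have dt : (t j - t i) ^+ 2 <= (2 / M%:R) ^+ 2.
  have /andP[v0 _] := v_bd i; have /andP[v0' _] := v_bd j.
  have /andP[l1 r1] := truncn_itv v0; have /andP[l2 r2] := truncn_itv v0'.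
  rewrite bij -!natr1 in l1 r1; rewrite -!natr1 in r2.
  have -> : t j - t i = (v j - v i) * (2 / M%:R).
    by rewrite /v; field; rewrite gt_eqF.
  rewrite exprMn -[leRHS]mul1r; apply: ler_wpM2r; first exact: sqr_ge0.
  by rewrite -real_normK ?num_real // expr_le1 // ler_norml; lra.
have ds : (s j - s i) ^+ 2 <= (t j - t i) ^+ 2.
  by apply: same_arc_le => //; rewrite sij.
have chord : nm (alpha ^+ j - alpha ^+ i) ^+ 2 = (s j - s i) ^+ 2 + (t j - t i) ^+ 2.
  have -> : nm (alpha ^+ j - alpha ^+ i) ^+ 2 = (x j - x i) ^+ 2 + (y j - y i) ^+ 2.
    rewrite norm_re_im; congr (_ ^+ 2 + _ ^+ 2); apply: val_inj; rewrite /= ?raddfB //.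
  by rewrite /s /t fij; case: ifP => _ //; rewrite addrC.
suff : nm (alpha ^+ j - alpha ^+ i) <= V%:R^-1.
  by rewrite -[V%:R^-1 in X in _ -> X](_ : algRval V%:R^-1 = _) // fmorphV rmorph_nat.
rewrite -(ler_pXn2r (n := 2)) ?nnegrE ?nm_ge0 ?invr_ge0 // chord.
(* The squared chord is at most [8/9] of [V^-2], hence the [3 * V] pieces per arc. *)
apply: (@le_trans _ _ (2 * (2 / M%:R) ^+ 2)); first by lra.
have V1 : 0 < V%:R^-1 :> algR by rewrite invr_gt0 ltr0n.
have -> : 2 / M%:R = V%:R^-1 * (2 / 3) :> algR.
  by rewrite /M natrM; field; rewrite pnatr_eq0 -lt0n V0.
have := sqr_ge0 (V%:R^-1 : algR); rewrite exprMn; lra.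
Qed.

Lemma param_w_bound D k p : (0 < D)%N -> (6 < k)%N -> (0 < p)%N ->
  (3 * (3 * D * p + 2 * k * D + 2) <= 9 * (D * k * p))%N.
Proof.
move=> D0 k6 p0.
have h2 : (7 * (D * p) <= D * k * p)%N by rewrite [(D * k)%N]mulnC -mulnA leq_mul2r k6 orbT.
have h3 : (D * k <= D * k * p)%N by rewrite leq_pmulr.
have h4 : (7 <= D * k)%N by apply: leq_trans (leq_mul D0 k6).
rewrite -mulnA [(2 * k * D)%N]mulnAC -mulnA; lia.
Qed.

(* The gain [2 ^ 'C(N, 2)] in the determinant of order [N = K * L] has to beat everything else to
   the power [N].  [D] exceeds the number [k ^ 2] of conjugates; the factor [64 * D * l] in [L] takes
   care of factorials and powers of [n < 2 ^ l.+1]; [w] is for the heights of [alpha ^+ p] and of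
   [f^`().[z]]; the term with [kap] in [K] is for the points of the size of [S * q]. *)
Section ParamChoice.
Variables k l n p m V D L w q t kap S T K N X : nat.
Hypotheses (k_gt6 : (6 < k)%N) (l_gt1 : (1 < l)%N) (p_gt0 : (0 < p)%N) (m_gt0 : (0 < m)%N).
Hypotheses (n_ge : (2 ^ l <= n)%N) (n_lt : (n < 2 ^ l.+1)%N).
Hypotheses (DE : D = (2 * k * k)%N) (LE : L = (64 * D * l)%N)
  (wE : w = (3 * (3 * D * p + 2 * k * D + 2))%N) (qE : q = (n %/ p)%N) (tE : t = (n %% p)%N)
  (kapE : kap = (q %/ (V * L)).+1) (SE : S = (2 * w * L)%N) (TE : T = (L * (4 * w + 12 * kap))%N)
  (KE : K = (w * (T + L + S) + 6 * S * kap)%N) (NE : N = (K * L)%N) (XE : X = (T + L + S * q)%N).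
Hypothesis V_ge : (32 * 64 * (m * L * D * k) <= V)%N.
Hypothesis n_big : (256 * (m * (L * L) * (w * w)) <= n)%N.
Hypothesis V_le : (V <= n)%N.

Lemma param_D_gt0 : (0 < D)%N. Proof. by rewrite DE !muln_gt0 /=; lia. Qed.
Lemma param_L_gt1 : (1 < L)%N.
Proof.
have D0 := param_D_gt0.
by rewrite LE -mulnA; have : (0 < D * l)%N; [rewrite muln_gt0; lia | lia].
Qed.
Lemma param_w_gt0 : (0 < w)%N. Proof. by rewrite wE; lia. Qed.
Lemma param_p_le_w : (p <= w)%N.
Proof.
have : (p <= D * p)%N by rewrite leq_pmull // param_D_gt0.
by rewrite wE -mulnA; lia.
Qed.

Lemma param_w_le : (w <= 9 * (D * k * p))%N.
Proof. by rewrite wE; apply: param_w_bound => //; apply: param_D_gt0. Qed.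

Lemma param_q_le : (q * p <= n)%N. Proof. by rewrite qE leq_divM. Qed.
Lemma param_kap_le : (kap.-1 * (V * L) <= q)%N. Proof. by rewrite kapE leq_divM. Qed.
Lemma param_V_gt0 : (0 < V)%N.
Proof.
apply: leq_trans V_ge; have := param_L_gt1; have := param_D_gt0.
by rewrite !muln_gt0 m_gt0 /= => ->; lia.
Qed.
Lemma param_kap_gt : (q < kap * (V * L))%N.
Proof. by rewrite kapE ltn_ceil // muln_gt0 param_V_gt0; have := param_L_gt1; lia. Qed.
Lemma param_kapS : kap = kap.-1.+1. Proof. by rewrite kapE. Qed.

Lemma param_T_le : (T <= q)%N.
Proof.
have L1 := param_L_gt1; have w0 := param_w_gt0.
have V24 : (24 <= V)%N.
  apply: leq_trans V_ge; have : (0 < m * L * D * k)%N; last by lia.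
  by rewrite !muln_gt0 m_gt0 param_D_gt0; lia.
have h1 : (24 * (L * kap.-1) <= q)%N.
  apply: leq_trans param_kap_le; have -> : (24 * (L * kap.-1) = kap.-1 * (24 * L))%N by ring.
  by rewrite leq_mul2l leq_mul2r V24 !orbT.
have h2 : (32 * (w * L) <= q)%N.
  rewrite qE leq_divRL //; apply: leq_trans n_big.
  have e1 : (w * L * p <= w * L * w)%N by rewrite leq_mul2l param_p_le_w orbT.
  have e2 : (w * L * w <= m * (L * L) * (w * w))%N.
    have -> : (m * (L * L) * (w * w) = (m * L) * (w * L * w))%N by ring.
    by rewrite leq_pmull // muln_gt0 m_gt0; lia.
  rewrite -mulnA; lia.
have h3 : (L <= w * L)%N by rewrite leq_pmull.
rewrite TE param_kapS mulnDr mulnS mulnDr !(mulnCA L) [(L * w)%N]mulnC; lia.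
Qed.

(** [T * S] equals [2 w L T] by the choice of [S], and [4 w L S + 12 S kap L] by that of [T]. The
    mean of the two dominates [N], since [L <= S]. *)
Lemma param_N_le : (N <= T * S)%N.
Proof.
have L1 := param_L_gt1; have w0 := param_w_gt0.
have h : (w * L * L <= w * L * S)%N.
  by rewrite leq_mul2l SE leq_pmull ?orbT // muln_gt0.
have e1 : (2 * (w * L * T) = T * S)%N by rewrite SE; ring.
have e2 : (T * S = 4 * (w * L * S) + 12 * (S * kap * L))%N by rewrite TE; ring.
have -> : N = (w * L * T + (w * L * L + w * L * S) + 6 * (S * kap * L))%N by rewrite NE KE; ring.
lia.
Qed.

(** After [N <= T * S], the part without [kap.-1] is at most [n / 2] by [n_big], and the rest at
    most [864 / 2048] of [n] by [V_ge], since a large [V] keeps [kap] small. The smallness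
    [2 ^ (n %/ m)] is then at least [2 ^ (4 * N)], enough for the error bound. *)
Lemma param_mN_le : (4 * m * N <= n)%N.
Proof.
have L1 := param_L_gt1; have w0 := param_w_gt0.
apply: (@leq_trans (4 * m * (T * S))); first by rewrite leq_mul2l param_N_le orbT.
have -> : (4 * m * (T * S) = 32 * (m * (L * L) * (w * w)) + 96 * (m * (L * L) * w) * kap.-1
    + 96 * (m * (L * L) * w))%N.
  by rewrite TE SE {1}param_kapS; ring.
have h1 : (m * (L * L) * w <= m * (L * L) * (w * w))%N by rewrite leq_mul2l leq_pmulr ?orbT.
have h2 : (96 * (m * (L * L) * w) * kap.-1 <= 864 * (p * (m * L * D * k * L * kap.-1)))%N.
  apply: (@leq_trans (96 * (m * (L * L) * (9 * (D * k * p))) * kap.-1)).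
    by rewrite leq_mul2r !leq_mul2l param_w_le !orbT.
  by apply: eq_leq; ring.
have h3 : (32 * 64 * (p * (m * L * D * k * L * kap.-1)) <= n)%N.
  apply: leq_trans param_q_le; rewrite [(q * p)%N]mulnC [(32 * 64 * _)%N]mulnCA leq_mul2l.
  apply/orP; right; apply: leq_trans param_kap_le.
  have -> : (32 * 64 * (m * L * D * k * L * kap.-1) = kap.-1 * ((32 * 64 * (m * L * D * k)) * L))%N by ring.
  by rewrite leq_mul2l leq_mul2r V_ge !orbT.
lia.
Qed.

Lemma param_size_le : (24 <= N)%N /\ (S * L <= N)%N /\ (K <= N)%N /\ (X <= 2 ^ (4 * l))%N
  /\ (N <= 2 ^ (4 * l))%N /\ (4 * V <= 2 ^ (4 * l))%N.
Proof.
have L1 := param_L_gt1; have w0 := param_w_gt0.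
have KN : (K <= N)%N by rewrite NE leq_pmulr //; lia.
have sumK : (T + L + S <= K)%N.
  by rewrite KE (leq_trans (leq_pmull _ w0)) // leq_addr.
have Nn : (N <= n)%N by apply: leq_trans param_mN_le; rewrite leq_pmull // muln_gt0.
have SL : (S * L <= N)%N by rewrite NE leq_mul2r; lia.
have L64 : (64 <= L)%N by rewrite LE -mulnA leq_pmulr // muln_gt0 param_D_gt0 ltnW.
have P2 : (2 ^ l.+1 * 2 ^ l.+1 * 4 <= 2 ^ (4 * l))%N.
  by rewrite (_ : 4 = 2 ^ 2)%N // -!expnD leq_exp2l //; lia.
have P4 : (4 <= 2 ^ l.+1)%N by rewrite (leq_pexp2l (m := 2) (n1 := 2)) //; lia.
have nP := n_lt; set P := (2 ^ l.+1)%N in nP P2 P4.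
have qn : (q <= n)%N by rewrite qE leq_div.
have Xn : (X <= 4 * (P * P))%N.
  rewrite XE; have : (S * q <= n * n)%N by rewrite leq_mul //; lia.
  have : (n * n <= P * P)%N by rewrite leq_mul // ltnW.
  have : (P <= P * P)%N by rewrite leq_pmull; lia.
  lia.
have PP : (4 * P <= P * P * 4)%N by rewrite [(P * P * 4)%N]mulnC leq_mul2l leq_pmull; lia.
split; first by lia.
split=> //; split => //; split; first by apply: leq_trans Xn _; rewrite mulnC.
split; lia.
Qed.

Lemma param_err_le :
  (2 ^ N * (X ^ K * (S * L)) * 4 ^ (k * k + 2 * k) <= 2 ^ (n %/ m))%N.
Proof.
have L1 := param_L_gt1.
have [N24 [SL [KN [X4 [N4 V4]]]]] := param_size_le.
have h : (4 * N <= n %/ m)%N by rewrite leq_divRL // mulnAC param_mN_le.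
have XK : (X ^ K <= 2 ^ (4 * l * K))%N.
  rewrite expnM; case: (posnP K) => [->|K0]; first by rewrite !expn0.
  by rewrite leq_exp2r.
apply: (@leq_trans (2 ^ N * (2 ^ (4 * l * K) * 2 ^ (4 * l)) * 2 ^ (2 * (k * k + 2 * k)))).
  rewrite (expnM 2 2) leq_mul // leq_mul2l; apply/orP; right.
  by apply: leq_mul => //; apply: leq_trans N4.
rewrite -!expnD leq_exp2l //; apply: leq_trans h.
have D0 := param_D_gt0.
have h1 : (4 * l * K * 16 <= N)%N.
  rewrite NE LE; have -> : (K * (64 * D * l) = D * (64 * (l * K)))%N by ring.
  apply: leq_trans (leq_pmull _ D0); lia.
have K0 : (0 < K)%N.
  by rewrite lt0n; apply/eqP => K00; move: N24; rewrite NE K00 mul0n.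
have h2 : (4 * l <= 4 * l * K)%N by rewrite leq_pmulr.
have h3 : (2 * (k * k + 2 * k) <= N)%N.
  apply: (@leq_trans L); last by rewrite NE leq_pmull.
  rewrite LE DE; have kk : (7 * k <= k * k)%N by rewrite leq_mul2r k_gt6 orbT.
  have -> : (64 * (2 * k * k) * l = 128 * (k * k) * l)%N by ring.
  apply: leq_trans (leq_pmulr _ (ltnW l_gt1)).
  move: (k * k)%N kk => k2; clear; lia.
by move: (4 * l * K)%N (4 * l)%N (2 * (k * k + 2 * k))%N h1 h2 h3; clear; lia.
Qed.

(** [N * G] bounds the exponent of 2 on the left. Factorials and the [K]th powers take at most
    [N / 8] of [G], by the factor [64 * D * l] of [L]; the heights and [X %/ V] take at most
    [N / 3], by the factors 3 in [w] and 6 in [K]. As [1/8 + 1/3 = 11/24 < 1/2], ['C(N, 2)] wins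
    once [N >= 24]. *)
Lemma param_final :
  ((2 ^ (2 * k * L * S)) ^ N *
   (N`! * (X ^ K * 2 ^ (3 * L * (p * (T + L) + t * S) + 2 * k * L * S)) ^ N) ^ (k * k) *
    (N`! * (2 * ((4 * V) ^ K * 4 ^ (X %/ V).+1)) ^ N) < 2 ^ 'C(N, 2))%N.
Proof.
have L1 := param_L_gt1.
have [N24 [SL [KN [X4 [N4 V4]]]]] := param_size_le.
have K0 : (0 < K)%N.
  by rewrite lt0n; apply/eqP => K00; move: N24; rewrite NE K00 mul0n.
have powK Y : (Y <= 2 ^ (4 * l) -> Y ^ K <= 2 ^ (4 * l * K))%N.
  by move=> Yle; rewrite expnM leq_exp2r.
have factN : (N`! <= 2 ^ (4 * l * N))%N.
  rewrite expnM; apply: (@leq_trans (N ^ N)); last by rewrite leq_exp2r //; lia.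
  have ff j : (j`! <= j ^ j)%N.
    elim: j => // j IHj; rewrite factS expnS leq_mul2l /=.
    by apply: leq_trans IHj _; case: j => // j; rewrite leq_exp2r.
  exact: ff.
pose E1 := (3 * L * (p * (T + L) + t * S) + 2 * k * L * S)%N.
pose G := (2 * k * L * S + k * k * (4 * l + (4 * l * K + E1)) + 4 * l
           + (1 + 4 * l * K + 2 * (X %/ V).+1))%N.
apply: (@leq_ltn_trans (2 ^ (N * G))).
  have -> : (N * G = 2 * k * L * S * N + (4 * l * N + (4 * l * K + E1) * N) * (k * k)
     + (4 * l * N + (1 + 4 * l * K + 2 * (X %/ V).+1) * N))%N by rewrite /G; ring.
  rewrite [leqRHS]expnD [(2 ^ (2 * k * L * S * N + _))%N]expnD; apply: leq_mul; first apply: leq_mul.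
  - by rewrite -expnM.
  - rewrite [leqRHS]expnM leq_exp2r; last by rewrite muln_gt0; lia.
    rewrite [leqRHS]expnD; apply: leq_mul => //; rewrite [leqRHS]expnM leq_exp2r; last by lia.
    by rewrite [leqRHS]expnD leq_mul // powK.
  - rewrite [leqRHS]expnD; apply: leq_mul => //; rewrite [leqRHS]expnM leq_exp2r; last by lia.
    rewrite -addnA [leqRHS]expnD expn1 leq_mul // expnD (expnM 2 2) leq_mul //.
    exact: powK.
rewrite ltn_exp2l //.
have D0 := param_D_gt0.
have kkD : (k * k + 1 <= D)%N by rewrite DE; have : (0 < k * k)%N; [rewrite muln_gt0; lia | lia].
have g1 : (8 * (k * k * (4 * l + 4 * l * K) + 4 * l + 4 * l * K) <= N)%N.
  have -> : (8 * (k * k * (4 * l + 4 * l * K) + 4 * l + 4 * l * K) =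
    32 * l * ((k * k + 1) * (K + 1)))%N by ring.
  have -> : N = (32 * l * (D * (2 * K)))%N by rewrite NE LE; ring.
  by rewrite leq_mul2l leq_mul ?orbT //; lia.
have tp : (t <= p)%N by rewrite tE ltnW // ltn_pmod.
have e1 : (E1 <= L * ((3 * p + 2 * k) * (T + L + S)))%N.
  have : (t * S <= p * S)%N by rewrite leq_mul2r tp orbT.
  move=> h; apply: (@leq_trans (3 * L * (p * (T + L) + p * S) + 2 * k * L * S)).
    by rewrite /E1 leq_add2r leq_mul2l leq_add2l h orbT.
  have -> : (L * ((3 * p + 2 * k) * (T + L + S)) =
    3 * L * (p * (T + L) + p * S) + 2 * k * L * S + 2 * k * L * (T + L))%N by ring.
  exact: leq_addr.
have g2 : (2 * k * L * S + k * k * E1 <= L * ((3 * D * p + 2 * k * D) * (T + L + S)))%N.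
  have -> : (L * ((3 * D * p + 2 * k * D) * (T + L + S)) = D * (L * ((3 * p + 2 * k) * (T + L + S))))%N by ring.
  apply: leq_trans (leq_mul kkD (leqnn _)).
  rewrite mulnDl mul1n addnC leq_add //; first by rewrite leq_mul2l e1 orbT.
  have -> : (L * ((3 * p + 2 * k) * (T + L + S)) =
    2 * k * L * S + L * (3 * p * (T + L + S) + 2 * k * (T + L)))%N by ring.
  exact: leq_addr.
have g3 : (X %/ V <= T + L + S * kap * L)%N.
  have V0 := param_V_gt0; apply: (@leq_trans ((T + L + S * kap * L) * V %/ V)); last by rewrite mulnK.
  apply: leq_div2r; rewrite XE [leqRHS]mulnDl; apply: leq_add; first exact: leq_pmulr.
  have -> : (S * kap * L * V = S * (kap * (V * L)))%N by ring.
  by rewrite leq_mul2l ltnW ?orbT // param_kap_gt.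
have g4 : (2 * (T + L) + 3 <= L * (2 * (T + L + S)))%N.
  have : (2 * (2 * (T + L + S)) <= L * (2 * (T + L + S)))%N by rewrite leq_mul2r L1 orbT.
  by move: (L * (2 * (T + L + S)))%N => Y; move: L1; clear; lia.
have g5 : (3 * (L * ((3 * D * p + 2 * k * D) * (T + L + S)) + L * (2 * (T + L + S)) + 2 * (S * kap * L)) = N)%N.
  by rewrite NE KE wE; ring.
have GN : (24 * G <= 11 * N)%N.
  have -> : G = (2 * k * L * S + k * k * E1 + (k * k * (4 * l + 4 * l * K) + 4 * l + 4 * l * K)
    + 2 * (X %/ V) + 3)%N by rewrite /G; ring.
  move: g1 g2 g3 g4 g5.
  move: (2 * k * L * S + k * k * E1)%N (k * k * (4 * l + 4 * l * K) + 4 * l + 4 * l * K)%N.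
  move: (L * ((3 * D * p + 2 * k * D) * (T + L + S)))%N (L * (2 * (T + L + S)))%N.
  by move: (S * kap * L)%N (X %/ V)%N N24; clear; lia.
have : (N * (2 * G + 1) <= N * N.-1)%N by rewrite leq_mul2l; move: N24 GN; clear; lia.
rewrite bin2 mulnDr muln1 mulnCA; move: (N * N.-1)%N (N * G)%N N24; clear; lia.
Qed.

Lemma params_ok :
  [/\ (T <= q)%N, (K.-1 * L < T * S)%N,
    (2 ^ N * (X ^ K * (S * L)) * 4 ^ (k * k + 2 * k) <= 2 ^ (n %/ m))%N &
    ((2 ^ (2 * k * L * S)) ^ N *
     (N`! * (X ^ K * 2 ^ (3 * L * (p * (T + L) + t * S) + 2 * k * L * S)) ^ N) ^ (k * k) *
     (N`! * (2 * ((4 * V) ^ K * 4 ^ (X %/ V).+1)) ^ N) < 2 ^ 'C(N, 2))%N].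
Proof.
split; [exact: param_T_le | | exact: param_err_le | exact: param_final].
apply: leq_trans param_N_le; have [N24 _] := param_size_le.
rewrite NE ltn_mul2r prednK ?leqnn ?andbT; first by have := param_L_gt1; case: (L).
by rewrite lt0n; apply/eqP => K0; move: N24; rewrite NE K0.
Qed.
End ParamChoice.

(* The numerals are variables here, because [ring] expands those of type [nat] in unary. *)
Lemma size_monomial_le (k l c256 c32 c64 c9 c48 c2 : nat) :
  let m := ((c32 * k) ^ 3)%N in let D := (c2 * k * k)%N in let L := (c64 * D * l)%N in
  let V := (c32 * c64 * (m * L * D * k))%N in let W := (c9 * (D * k * (c48 * L * V)))%N in
  (c256 <= 2 ^ 8)%N -> (c32 <= 2 ^ 5)%N -> (c64 <= 2 ^ 6)%N -> (c2 <= 2 ^ 1)%N ->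
  (c9 * c48 <= 2 ^ 9)%N ->
  (c256 * (m * (L * L) * (W * W)) <= 2 ^ 139 * ((k ^ 3) ^ 11 * l ^ 6))%N.
Proof.
move=> m D L V W h256 h32 h64 h2 h948.
have -> : (c256 * (m * (L * L) * (W * W)) =
    c256 * c32 ^ 3 * (c64 * c2) ^ 2 *
    (c9 * c48 * c2 * (c64 * c2) * (c32 * c64 * (c32 ^ 3 * (c64 * c2) * c2))) ^ 2 *
    ((k ^ 3) ^ 11 * l ^ 6))%N.
  rewrite /W /V /L /D /m; ring.
rewrite leq_mul2r; apply/orP; right.
have h32' : (c32 ^ 3 <= 2 ^ 15)%N by rewrite (expnM 2 5 3) leq_exp2r.
have hL := leq_mul h64 h2; have hV := leq_mul (leq_mul h32' hL) h2.
have hV' := leq_mul (leq_mul h32 h64) hV.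
have hW := leq_mul (leq_mul (leq_mul h948 h2) hL) hV'.
have sq x y : (x <= y -> x ^ 2 <= y ^ 2)%N by move=> xy; rewrite leq_exp2r.
apply: leq_trans (leq_mul (leq_mul (leq_mul h256 h32') (sq _ _ hL)) (sq _ _ hW)) _.
have E b : (b ^ 8 * b ^ 15 * (b ^ 6 * b ^ 1) ^ 2 * (b ^ 9 * b ^ 1 * (b ^ 6 * b ^ 1) *
   (b ^ 5 * b ^ 6 * (b ^ 15 * (b ^ 6 * b ^ 1) * b ^ 1))) ^ 2 = b ^ 139)%N by ring.
by rewrite E leqnn.
Qed.

(** As [k^3 <= 2 l], the left side is at most [2^(167 + 17 a)] with [a] the integer part of
    [log2 l]. From [k = 7] on the hypothesis forces [l >= 305], while [167 + 17 * 8 = 303]; for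
    [a >= 9] already [2^a] is larger. *)
Lemma size_condition (k l : nat) :
  let m := ((32 * k) ^ 3)%N in let D := (2 * k * k)%N in let L := (64 * D * l)%N in
  let V := (32 * 64 * (m * L * D * k))%N in let W := (9 * (D * k * (48 * L * V)))%N in
  (2 * k ^ 3 + 228 <= 3 * l)%N -> (6 < k)%N ->
  (256 * (m * (L * L) * (W * W)) <= 2 ^ l)%N.
Proof.
move=> m D L V W kl k6.
have l305 : (305 <= l)%N.
  have : (7 ^ 3 <= k ^ 3)%N by rewrite leq_exp2r.
  rewrite (_ : 7 ^ 3 = 343)%N //; clear -kl; lia.
have k3 : (k ^ 3 <= 2 * l)%N by clear -kl; lia.
have mono := @size_monomial_le k l 256 32 64 9 48 2 isT isT isT isT isT.
apply: leq_trans mono _.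
pose a := trunc_log 2 l.
have /andP[al la] := trunc_log_bounds (isT : (1 < 2)%N) (leq_trans (isT : (0 < 305)%N) l305).
rewrite -/a in al la.
apply: (@leq_trans (2 ^ 139 * ((2 ^ a.+2) ^ 11 * (2 ^ a.+1) ^ 6))).
  rewrite leq_mul2l; apply/orP; right; apply: leq_mul; rewrite leq_exp2r //; last exact: ltnW.
  by apply: leq_trans k3 _; rewrite [leqRHS]expnS leq_mul2l ltnW.
have E b : (b ^ 139 * ((b ^ a.+2) ^ 11 * (b ^ a.+1) ^ 6) = b ^ (167 + 17 * a))%N.
  by rewrite -!expnM -!expnD; congr (_ ^ _)%N; clear; lia.
rewrite E leq_exp2l //.
have [a8|a9] := leqP a 8; first by move: l305 a8; clear; lia.
have : (167 + 17 * a <= 2 ^ a)%N.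
  rewrite -(subnK a9); elim: (a - 9)%N => [|j IHj]; first by [].
  by rewrite addSn [leqRHS]expnS; clear -IHj; set P := (2 ^ _)%N in IHj *; lia.
by move: al; move: (2 ^ a)%N => P; clear; lia.
Qed.

(** [W] bounds [w] for every [p <= 48 * L * V] that the pigeonhole argument may return, so that the
    size condition on [n] involves only [k] and [l]. *)
Lemma pell_rec_no_large_zero (k n l : nat) (U : nat -> algC) :
  let m := ((32 * k) ^ 3)%N in let D := (2 * k * k)%N in let L := (64 * D * l)%N in
  let V := (32 * 64 * (m * L * D * k))%N in let W := (9 * (D * k * (48 * L * V)))%N in
  (6 < k)%N -> odd k -> (1 < l)%N -> (2 ^ l <= n)%N -> (n < 2 ^ l.+1)%N ->
  (256 * (m * (L * L) * (W * W)) <= n)%N -> pell_rec k U ->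
  (forall j, (j < k)%N -> U j = (j == k.-1)%:R) -> U n != 0.
Proof.
move=> m D L V W k6 kodd l1 nge nlt big recU initU; apply/eqP => Un0.
have [z [rz z1 Lam]] := pell_zero_Lambda k6 kodd recU initU Un0.
have k2 : (2 < k)%N by apply: leq_trans k6.
have tors j : (0 < j)%N -> (z / z^*) ^+ j != 1 by move=> j0; exact: (pellpoly_root_nontorsion k2 kodd rz z1 j0).
have alpha1 : `|z / z^*| = 1.
  by rewrite normf_div norm_conjC divff // normr_eq0 (pellpoly_root_neq0 rz).
have m0 : (0 < m)%N by rewrite expn_gt0; lia.
have D0 : (0 < D)%N by rewrite /D !muln_gt0; lia.
have L0 : (0 < L)%N by rewrite /L (muln_gt0 (64 * D)) (muln_gt0 64 D) D0; lia.
have V0 : (0 < V)%N 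
  by rewrite /V (muln_gt0 (32 * 64)) (muln_gt0 _ k) (muln_gt0 _ D) (muln_gt0 m L) m0 L0 D0; lia.
have VL0 : (0 < 4 * L * V)%N by rewrite (muln_gt0 _ V) (muln_gt0 4 L) L0 V0.
have [p /andP[p0 ple] ap] := unit_circle_dirichlet VL0 alpha1.
have wW : (3 * (3 * D * p + 2 * k * D + 2) <= W)%N.
  apply: leq_trans (param_w_bound D0 k6 p0) _; rewrite !leq_mul2l.
  have -> : (48 * L * V = 12 * (4 * L * V))%N by ring.
  by rewrite ple !orbT.
have W0 : (0 < W)%N by apply: leq_trans wW; rewrite muln_gt0 addn_gt0 orbT.
have M0 : (0 < m * (L * L))%N by rewrite (muln_gt0 m) (muln_gt0 L L) m0 L0.
have Vn : (V <= n)%N.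
  apply: leq_trans big; apply: (@leq_trans W).
    rewrite /W; have -> : (9 * (D * k * (48 * L * V)) = 9 * D * k * 48 * L * V)%N by ring.
    by apply: leq_pmull; rewrite (muln_gt0 _ L) (muln_gt0 _ 48) (muln_gt0 _ k) (muln_gt0 9 D) D0 L0; lia.
  have h1 : (W <= W * W)%N by apply: leq_pmull.
  have h2 : (W * W <= m * (L * L) * (W * W))%N by apply: leq_pmull.
  by apply: leq_trans (leq_trans h1 h2) _; apply: leq_pmull.
have wbig : (256 * (m * (L * L) * ((3 * (3 * D * p + 2 * k * D + 2)) * (3 * (3 * D * p + 2 * k * D + 2)))) <= n)%N.
  by apply: leq_trans big; rewrite leq_mul2l leq_mul2l leq_mul ?orbT.
have [Tq KLTS errN fin] := params_ok k6 l1 p0 m0 nge nlt (erefl D) (erefl L) erefl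
  erefl erefl erefl erefl erefl erefl erefl erefl (leqnn V) wbig Vn.
apply: (two_log_contradiction k2 rz tors p0 V0 Tq KLTS ap) fin.
  by rewrite -divn_eq; apply: Lam.
rewrite mulrA -natrM ler_pdivrMr ?mul1r ?ler_nat //.
by rewrite ltr0n expn_gt0.
Qed.

(** * Zeros and p-adic expansions *)

Section PAdicZeros.
Variables (k T p : nat) (v : nat -> int) (f : {poly int}).
Hypotheses (k_gt1 : (1 < k)%N) (p_pr : prime p) (p_gt2 : (2 < p)%N).
Hypotheses (mon_f : f \is monic) (sz_f : size f = k.+1).
Hypothesis rec_v : forall j, \sum_(i < k.+1) f`_i * v (j + i)%N = 0.
Hypotheses (v0 : v 0 = 1) (v_small : forall j, (0 < j < k)%N -> v j = 0) (vk : v k = 1).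

(* The linear form [X^i |-> v i], which vanishes on the multiples of [f]. *)
Let phi (P : {poly int}) : int := \sum_(i < size P) P`_i * v i.

Lemma phiE n (P : {poly int}) : (size P <= n)%N -> phi P = \sum_(i < n) P`_i * v i.
Proof.
move=> sP; rewrite /phi -!(big_mkord xpredT (fun i => P`_i * v i)).
rewrite [RHS](big_cat_nat (n := size P)) //= [X in _ + X]big_nat [X in _ + X]big1 ?addr0 // => i /andP[si _].
by rewrite nth_default ?mul0r.
Qed.

Lemma phiD P Q : phi (P + Q) = phi P + phi Q.
Proof.
have m := leq_maxl (size P) (size Q); have m' := leq_maxr (size P) (size Q).
rewrite (phiE m) (phiE m') (phiE (size_polyD P Q)) -big_split /=.
by apply: eq_bigr => i _; rewrite coefD mulrDl.
Qed.

Lemma phiZ c P : phi (c *: P) = c * phi P.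
Proof.
rewrite (phiE (size_scale_leq c P)) /phi mulr_sumr.
by apply: eq_bigr => i _; rewrite coefZ mulrA.
Qed.

Lemma phi0 : phi 0 = 0. Proof. by rewrite /phi size_poly0 big_ord0. Qed.

Lemma phi_sum (I : Type) (r : seq I) (F : I -> {poly int}) :
  phi (\sum_(i <- r) F i) = \sum_(i <- r) phi (F i).
Proof. exact: (big_morph phi phiD phi0). Qed.

Lemma phiXnM j (P : {poly int}) n : (size P <= n)%N -> phi ('X^j * P) = \sum_(i < n) P`_i * v (j + i)%N.
Proof.
move=> sP; rewrite (phiE (n := (j + n)%N)); last first.
  by apply: leq_trans (size_polyMleq _ _) _; rewrite size_polyXn addSn /= leq_add2l.
rewrite -(big_mkord xpredT (fun i => ('X^j * P)`_i * v i)) (big_cat_nat (n := j)) ?leq_addr //=.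
rewrite big_nat big1 ?add0r => [|i /andP[_ ij]]; last by rewrite coefXnM ij mul0r.
rewrite -[X in index_iota X _]add0n big_addn addKn big_mkord; apply: eq_bigr => i _.
by rewrite coefXnM ltnNge leq_addl /= addnK [(i + j)%N]addnC.
Qed.

Lemma phiXn j : phi 'X^j = v j.
Proof.
by rewrite -['X^j]mulr1 (@phiXnM j 1 1) ?size_poly1 // big_ord1 coef1 mul1r addn0.
Qed.

Lemma phi_mul_f Q : phi (Q * f) = 0.
Proof.
rewrite -[Q]coefK poly_def mulr_suml phi_sum big1 // => i _.
by rewrite -scalerAl phiZ (@phiXnM i f k.+1) ?sz_f // rec_v mulr0.
Qed.

Lemma int_poly_dvd (c : int) (P : {poly int}) : (forall i, (c %| P`_i)%Z) -> exists Q, P = c *: Q.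
Proof.
move=> h; exists (\poly_(i < size P) (P`_i %/ c)%Z); apply/polyP => i.
rewrite coefZ coef_poly; case: ltnP => [_|si]; first by rewrite mulrC divzK.
by rewrite nth_default ?mulr0.
Qed.

(** The remainder of [X^T - 1] modulo [f] pairs with [X^j] to [v (T + j) - v j]. As [v] starts with
    1, zeros and [v k = 1], the system is triangular: [j = 0] isolates the constant coefficient, and
    [j > 0] that of degree [k - j] up to those of higher degree. *)
Lemma poly_period :
  (forall j, (j < k)%N -> (p%:Z %| v (T + j)%N - v j)%Z) ->
  exists b h, 'X^T = 1 + p%:Z *: b + h * f :> {poly int}.
Proof.
move=> per.
pose sig := Pdiv.Ring.rmodp 'X^T f - 1.
pose h := Pdiv.Ring.rdivp 'X^T f.
have divE : 'X^T = 1 + sig + h * f.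
  rewrite [LHS](Pdiv.RingMonic.rdivp_eq mon_f) /sig /h; ring.
have f0 : f != 0 by rewrite -size_poly_gt0 sz_f.
have szs : (size sig <= k)%N.
  apply: leq_trans (size_polyD _ _) _; rewrite size_polyN size_poly1 geq_max.
  by have := Pdiv.Ring.ltn_rmodpN0 'X^T f0; rewrite sz_f ltnS => ->; apply: ltnW.
have phis j : phi ('X^j * sig) = v (T + j)%N - v j.
  have : phi ('X^j * 'X^T) = phi 'X^j + phi ('X^j * sig).
    by rewrite divE !mulrDr mulr1 !phiD mulrA phi_mul_f addr0.
  by rewrite -exprD !phiXn addnC => ->; rewrite addrC addKr.
suff dvds i : (i < k)%N -> (p%:Z %| sig`_i)%Z.
  have [|b bE] := @int_poly_dvd p%:Z sig; last by exists b, h; rewrite -bE.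
  move=> i; have [ik|ki] := ltnP i k; first exact: dvds.
  by rewrite nth_default ?dvdz0 // (leq_trans szs).
have dvds0 : (p%:Z %| sig`_0)%Z.
  have := per 0 (ltnW k_gt1); rewrite -phis (phiXnM _ szs).
  have k0 := ltnW k_gt1.
  rewrite (bigD1 (Ordinal k0)) //= v0 mulr1 big1 ?addr0 // => i1; rewrite -val_eqE /= => i0.
  by rewrite v_small ?mulr0 // add0n lt0n i0 /=.
have dvdj j : (0 < j < k)%N -> (p%:Z %| sig`_(k - j))%Z.
  elim/ltn_ind: j => j IH /andP[j0 jk].
  have := per j jk; rewrite -phis (phiXnM _ szs).
  have kj : (k - j < k)%N by lia.
  rewrite (bigD1 (Ordinal kj)) //= subnKC ?(ltnW jk) // vk mulr1 rpredDr //.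
  apply: rpred_sum => i1; rewrite -val_eqE /= => ikj.
  have [lt|ge] := ltnP i1 (k - j)%N.
    by rewrite v_small ?mulr0 ?rpred0 //; lia.
  apply: dvdz_mulr; have -> : (i1 : nat) = (k - (k - i1))%N by have := ltn_ord i1; lia.
  by apply: IH; have := ltn_ord i1; lia.
case: i => [|i] ik //.
have -> : i.+1 = (k - (k - i.+1))%N by lia.
by apply: dvdj; lia.
Qed.

Lemma pow_1pD3 (R : comNzRingType) (c Y : R) m :
  exists W, (1 + c * Y) ^+ m = 1 + m%:R * (c * Y) + 'C(m, 2)%:R * (c * Y) ^+ 2 + c ^+ 3 * W.
Proof.
elim: m => [|m [W IHm]]; first by exists 0; rewrite expr0 bin0n mulr0n; ring.
exists (W + 'C(m, 2)%:R * Y ^+ 3 + c * Y * W).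
by rewrite exprS IHm binS bin1 natrD -natr1; ring.
Qed.

(** Since [p] is odd, it divides ['C(p, 2)], and the quadratic term is of higher order even for
    [a = 0]. *)
Lemma pow_p_1pD (R : comNzRingType) (a : nat) (Y : R) :
  exists W, (1 + p%:R ^+ a.+1 * Y) ^+ p = 1 + p%:R ^+ a.+2 * (Y + p%:R * W).
Proof.
have [W ->] := pow_1pD3 (p%:R ^+ a.+1) Y p.
have op : odd p by case: (even_prime p_pr) p_gt2 => // ->.
exists ((p.-1)./2%:R * p%:R ^+ a * Y ^+ 2 + p%:R ^+ (2 * a) * W).
rewrite bin2odd // natrM !exprSr mul2n -addnn exprD; ring.
Qed.

Lemma pow_pX_1pD (R : comNzRingType) (a : nat) (b : R) :
  exists W, (1 + p%:R * b) ^+ (p ^ a) = 1 + p%:R ^+ a.+1 * (b + p%:R * W).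
Proof.
elim: a => [|a [W IHa]]; first by exists 0; rewrite expn0 !expr1 mulr0 addr0.
rewrite expnSr exprM IHa; have [W' ->] := pow_p_1pD a (b + p%:R * W).
by exists (W + W'); ring.
Qed.

(* Modulo [f], [X^T = 1 + p b]; hence if [n = r + p^a m T] with [m] prime to [p], then
   [v n = v r + p^(a+1) (m phi(X^r b) + p c)], where [p phi(X^r b) = v (r + T) - v r]. *)
Lemma padic_zero_bound :
  (forall j, (j < k)%N -> (p%:Z %| v (T + j)%N - v j)%Z) -> (0 < T)%N ->
  (forall r, (r < T)%N -> (p%:Z %| v r)%Z -> v r = 0 /\ ~~ (p%:Z ^+ 2 %| v (r + T)%N)%Z) ->
  forall n, v n = 0 -> (n < T)%N.
Proof.
move=> per T0 res n vn0; have [b [h XT]] := poly_period per.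
rewrite ltnNge; apply/negP => Tn.
pose r := (n %% T)%N; pose l := (n %/ T)%N.
have rT : (r < T)%N by rewrite ltn_mod.
have l0 : (0 < l)%N by rewrite divn_gt0.
have [m' pm' lE] := pfactor_coprime p_pr l0.
set a := logn p l in lE.
have phir (Q : {poly int}) : phi ('X^r * (1 + p%:R ^+ a.+1 * Q)) = v r + p%:Z ^+ a.+1 * phi ('X^r * Q).
  rewrite mulrDr mulr1 phiD phiXn mulrCA.
  by rewrite -[p%:R]polyC_natr -polyC_exp mul_polyC phiZ natz.
have modf (P Q : {poly int}) j : exists H, (P + Q * f) ^+ j = P ^+ j + H * f.
  elim: j => [|j [H IHj]]; first by exists 0; rewrite !expr0 mul0r addr0.
  by exists (P * H + Q * P ^+ j + Q * H * f); rewrite !exprS IHj; ring.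
have pbE : 1 + p%:Z *: b = 1 + p%:R * b :> {poly int}.
  by rewrite -mul_polyC -[p%:R]polyC_natr natz.
have [W2 e1] := pow_pX_1pD a b.
have [W3 e2] := pow_1pD3 (p%:R ^+ a.+1) (b + p%:R * W2) m'.
pose W := m'%:R * W2 + 'C(m', 2)%:R * p%:R ^+ a * (b + p%:R * W2) ^+ 2 + p%:R ^+ a.+1 * p%:R ^+ a * W3.
have pow_l : (1 + p%:R * b) ^+ l = 1 + p%:R ^+ a.+1 * (m'%:R * b + p%:R * W).
  by rewrite lE mulnC exprM e1 e2 /W !exprSr; ring.
have vnE : v n = v r + p%:Z ^+ a.+1 * (m'%:Z * phi ('X^r * b) + p%:Z * phi ('X^r * W)).
  have [H HE] := modf (1 + p%:R * b) h l.
  rewrite -(phiXn n) (divn_eq n T) -/r -/l addnC mulnC exprD exprM XT pbE HE pow_l.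
  rewrite mulrDr phiD mulrA phi_mul_f addr0 phir; congr (_ + _ * _).
  rewrite mulrDr phiD; congr (_ + _).
    by rewrite mulrCA -[m'%:R]polyC_natr mul_polyC phiZ natz.
  by rewrite mulrCA -[p%:R]polyC_natr mul_polyC phiZ natz.
have pvr : (p%:Z %| v r)%Z.
  move: vnE; rewrite vn0 => /esym/eqP; rewrite addr_eq0 => /eqP ->.
  by rewrite rpredN exprS -mulrA dvdz_mulr.
have [vr0 /negP] := res r rT pvr; apply.
have p0 : p%:Z != 0 by rewrite eqz_nat -lt0n prime_gt0.
have vrT : v (r + T)%N = p%:Z * phi ('X^r * b).
  rewrite -(phiXn (r + T)) exprD XT pbE !mulrDr mulr1 !phiD phiXn vr0 add0r ['X^r * (h * f)]mulrA phi_mul_f addr0.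
  by rewrite mulrCA -[p%:R]polyC_natr mul_polyC phiZ natz.
rewrite vrT expr2 dvdz_mul2l //.
have co : coprimez p%:Z m'%:Z by [].
rewrite -(Gauss_dvdzr _ co).
have /eqP : p%:Z ^+ a.+1 * (m'%:Z * phi ('X^r * b) + p%:Z * phi ('X^r * W)) = 0.
  by move: vnE; rewrite vn0 vr0 add0r => <-.
rewrite mulf_eq0 expf_eq0 (negPf p0) andbF /= addr_eq0 => /eqP ->.
by rewrite rpredN dvdz_mulr.
Qed.
End PAdicZeros.

(** * The sequence run backwards *)

Definition pell_back (k : nat) (v : nat -> int) : Prop :=
  [/\ v 0%N = 1, forall j, (0 < j < k)%N -> v j = 0, v k = 1 &
      forall j, v (j + k.+1)%N = 3 * v j.+1 - v j - v j.+2].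

(** By the short recurrence the expression does not depend on [j], and at [j = 0] it is
    [1 + 1 - 2]. *)
Lemma pell_back_sum k v : (2 < k)%N -> pell_back k v ->
  forall j, \sum_(i < k.+1) v (j + i)%N + (v j.+1 - 2 * v j) = 0.
Proof.
move=> k2 [v0 vs vk rv]; elim=> [|j IHj].
  rewrite big_ord_recr /= add0n vk.
  have k0 : (0 < k)%N by lia.
  have -> : v 1 = 0 by rewrite vs //; lia.
  rewrite (bigD1 (Ordinal k0)) //= v0 big1 // => i; rewrite -val_eqE /= -lt0n add0n => i0.
  by rewrite vs // i0 /=.
rewrite -[RHS]IHj big_ord_recr [in RHS]big_ord_recl /= addn0.
rewrite (eq_bigr (fun i : 'I_k => v (j + bump 0 i)%N)) => [|i _]; last by rewrite /bump /= addSnnS.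
by rewrite addSnnS rv; ring.
Qed.

Lemma pell_back_padic (k T p : nat) (v : nat -> int) :
  (2 < k)%N -> pell_back k v -> prime p -> (2 < p)%N -> (0 < T)%N ->
  (forall j, (j < k)%N -> (p%:Z %| v (T + j)%N - v j)%Z) ->
  (forall r, (r < T)%N -> (p%:Z %| v r)%Z -> v r = 0 /\ ~~ (p%:Z ^+ 2 %| v (r + T)%N)%Z) ->
  forall n, v n = 0 -> (n < T)%N.
Proof.
move=> k2 bv pp p2 T0 per res; have [v0 vs vk _] := bv.
apply: (@padic_zero_bound k T p v (pellpoly int k)) => //; first exact: ltnW.
- exact: monic_pellpoly.
- exact: size_pellpoly.
- by move=> j; rewrite pellpoly_rec_sum // pell_back_sum.
Qed.

Lemma pell_back_bound (k n e : nat) (v : nat -> int) : (6 < k)%N -> odd k -> pell_back k v ->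
  (2 * k ^ 3 + 228 <= 3 * e)%N -> (2 ^ e <= n)%N -> v n.+1 <> 0.
Proof.
move=> k6 kodd bv ke nbig vn0; have k2 : (2 < k)%N by apply: leq_trans k6.
have n0 : (0 < n)%N by apply: leq_trans nbig; rewrite expn_gt0.
pose l := trunc_log 2 n.
have /andP[nl ln] := trunc_log_bounds (isT : (1 < 2)%N) n0.
have el : (e <= l)%N by rewrite -ltnS -(@ltn_exp2l 2) //; apply: leq_ltn_trans nbig ln.
have kl : (2 * k ^ 3 + 228 <= 3 * l)%N by apply: leq_trans ke _; rewrite leq_mul2l.
have big := leq_trans (size_condition kl k6) nl.
have l1 : (1 < l)%N by move: kl; clear; lia.
(* The shift by one makes the initial values [0, ..., 0, 1], those of the Lagrange sum. *)
pose U j : algC := (v j.+1)%:~R.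
have recU : pell_rec k U.
  move=> j; rewrite /U -[RHS](rmorph0 intr) -(pell_back_sum k2 bv j.+1).
  by rewrite rmorphD rmorph_sum rmorphB rmorphM rmorph_nat.
have := @pell_rec_no_large_zero k n l U k6 kodd l1 nl ln big recU.
have [v0 vs vk _] := bv.
rewrite /U vn0 eqxx => /(_ _)/negP; apply=> // j jk.
have k0 : (0 < k)%N by apply: ltnW (ltnW k2).
case: eqP => [->|jk1]; first by rewrite prednK ?vk.
rewrite vs //; move: jk jk1 k0; clear; lia.
Qed.

Lemma dvdz_int_of_Z (d : nat) (x : Z) : (0 < d)%N ->
  (d%:Z %| int_of_Z x)%Z = Z.eqb (Z.modulo x (Z.of_nat d)) Z0.
Proof.
move=> d0; have dn0 : Z.of_nat d <> Z0 by lia.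
have dE : int_of_Z (Z.of_nat d) = Posz d by apply: (can_inj Z_of_intK); rewrite int_of_ZK.
apply/dvdzP/Z.eqb_spec => [[q hq]|].
  apply/(Z.mod_divide _ _ dn0); exists (Z_of_int q).
  by apply: (can_inj int_of_ZK); rewrite hq rmorphM /= Z_of_intK dE.
by case/(Z.mod_divide _ _ dn0) => q ->; exists (int_of_Z q); rewrite rmorphM /= dE.
Qed.

Lemma pell_back_pell_rev k : (1 < k)%N -> pell_back k (int_of_Z \o pell_rev k).
Proof.
move=> k1; have k1' : Peano.le 2 k by apply/ssrnat.leP.
split=> [|j /andP[j0 jk]||j] /=; first by [].
- by rewrite pell_rev_small //; split; apply/ssrnat.ltP.
- by rewrite pell_rev_k.
- by rewrite (pell_rev_rec k k1' j) !rmorphB rmorphM.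
Qed.

Lemma pell_rev_padic (k T p : nat) : Peano.lt 2 k -> prime p -> Peano.lt 2 p -> Peano.lt 0 T ->
  all (fun j => Z.eqb (Z.modulo (Z.sub (pell_rev k (T + j)) (pell_rev k j)) (Z.of_nat p)) Z0) (iota 0 k) ->
  all (fun r => Z.eqb (Z.modulo (pell_rev k r) (Z.of_nat p)) Z0 ==>
     Z.eqb (pell_rev k r) Z0 && ~~ Z.eqb (Z.modulo (pell_rev k (r + T)) (Z.of_nat (p ^ 2))) Z0) (iota 0 T) ->
  forall n, pell_rev k n = Z0 -> Peano.lt n T.
Proof.
move=> /ssrnat.ltP k2 pp /ssrnat.ltP p2 /ssrnat.ltP T0 /allP per /allP res n un; apply/ssrnat.ltP.
have p0 : (0 < p)%N by apply: ltnW (ltnW p2).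
apply: (pell_back_padic k2 (pell_back_pell_rev (ltnW k2)) pp p2 T0); last by rewrite /= un.
  move=> j jk; rewrite /= -rmorphB dvdz_int_of_Z //.
  by apply: per; rewrite mem_iota.
move=> r rT; rewrite /= dvdz_int_of_Z // => rp.
have : r \in iota 0 T by rewrite mem_iota.
move=> /res/implyP/(_ rp)/andP[/Z.eqb_spec -> nr].
by split=> //; rewrite expr2 -PoszM mulnn dvdz_int_of_Z // expn_gt0 p0.
Qed.

Lemma pell_rev_large (k n e : nat) : Peano.lt 6 k -> Nat.Odd k ->
  Peano.le (2 * Nat.pow k 3 + 228) (3 * e) -> Peano.le (Nat.pow 2 e) n -> pell_rev k (S n) <> Z0.
Proof.
have powE a b : Nat.pow a b = (a ^ b)%N by elim: b => //= b ->; rewrite expnS.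
rewrite !powE => /ssrnat.ltP k6 [m km] /ssrnat.leP ke /ssrnat.leP nbig un.
have kodd : odd k by move: km; clear; lia.
have k1 : (1 < k)%N by apply: leq_trans k6.
by apply: (pell_back_bound k6 kodd (pell_back_pell_rev k1) ke nbig); rewrite /= un.
Qed.

End TwoLogarithms.

(** * Comparison with the stated real bounds *)

Lemma one_le_ln x : (3 <= x)%R -> (1 <= ln x)%R.
Proof.
  intros Hx. rewrite <- (ln_exp 1). pose proof exp_le_3 as H3.
  destruct (Rle_lt_or_eq_dec (exp 1) x) as [H|<-]; [lra| |lra].
  left. apply ln_increasing; [apply exp_pos|exact H].
Qed.

Lemma even_real_bound (k n : nat) : (2 <= k)%nat -> (n < k * k)%nat ->
  (INR n < 2 * INR k ^ (k * k) * ln (16 * INR k ^ 2))%R.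
Proof.
  intros Hk Hn. assert (Hk2 : (2 <= INR k)%R) by (apply (le_INR 2) in Hk; exact Hk).
  apply lt_INR in Hn. rewrite mult_INR in Hn.
  assert (H1 : (1 <= ln (16 * INR k ^ 2))%R) by (apply one_le_ln; nra).
  assert (H2 : (INR k ^ 2 <= INR k ^ (k * k))%R) by (apply Rle_pow; [lra|nia]).
  nra.
Qed.

(** [231 = 3 * 77]: beyond [2^77] the comparison is made after cubing, where [3 (e - 77) <= 2 k^3]
    and [2^2 < 1.59^3]. *)
Lemma odd_real_bound (k n e : nat) : (7 <= k)%nat ->
  (3 * e <= 2 * k ^ 3 + 231)%nat -> (n < 2 ^ e)%nat ->
  (INR n < 75 / 10 * 10 ^ 14 * (159 / 100) ^ (k * k * k) * INR k ^ 10 * (ln (INR k)) ^ 2)%R.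
Proof.
  intros Hk He Hn.
  assert (Hk7 : (7 <= INR k)%R) by (apply (le_INR 7) in Hk; simpl in Hk; lra).
  assert (Hln : (1 <= ln (INR k) ^ 2)%R).
  { assert (H := one_le_ln (INR k) ltac:(lra)). nra. }
  assert (Hpow : (7 ^ 10 <= INR k ^ 10)%R) by (apply pow_incr; lra).
  set (a := (k * k * k)%nat) in *.
  assert (Ha : (k ^ 3 = a)%nat) by (unfold a; simpl; ring).
  rewrite Ha in He. set (b := ((159 / 100) ^ a)%R).
  assert (Hb : (0 < b)%R) by (apply pow_lt; lra).
  assert (Hmain : (2 ^ e <= 2 ^ 77 * b)%R).
  { destruct (Nat.le_gt_cases e 77) as [H|H].
    - assert (2 ^ e <= 2 ^ 77)%R by (apply Rle_pow; [lra|lia]).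
      assert (1 <= b)%R by (apply pow_R1_Rle; lra).
      assert (0 < 2 ^ 77)%R by (apply pow_lt; lra). nra.
    - replace e with (77 + (e - 77))%nat by lia. rewrite pow_add.
      apply Rmult_le_compat_l; [apply pow_le; lra|].
      apply Rnot_lt_le. intros Hlt.
      assert (H3 : (b ^ 3 < (2 ^ (e - 77)) ^ 3)%R).
      { set (c := (2 ^ (e - 77))%R) in *.
        assert (0 < (c - b) * (c * c + c * b + b * b))%R by (apply Rmult_lt_0_compat; nra). lra. }
      assert (E1 : (b ^ 3 = ((159 / 100) ^ 3) ^ a)%R).
      { unfold b. rewrite <- !pow_mult. f_equal. lia. }
      assert (H4 : ((2 ^ (e - 77)) ^ 3 <= (2 ^ 2) ^ a)%R).
      { rewrite <- !pow_mult. apply Rle_pow; [lra|lia]. }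
      assert (H5 : ((2 ^ 2) ^ a <= ((159 / 100) ^ 3) ^ a)%R) by (apply pow_incr; lra).
      lra. }
  apply lt_INR in Hn. rewrite pow_INR in Hn. change (INR 2) with 2%R in Hn.
  assert (Hc : (2 ^ 77 <= 75 / 10 * 10 ^ 14 * 7 ^ 10)%R) by lra.
  apply Rlt_le_trans with (1 := Hn). apply Rle_trans with (1 := Hmain).
  replace (75 / 10 * 10 ^ 14 * b * INR k ^ 10 * ln (INR k) ^ 2)%R
    with (b * (75 / 10 * 10 ^ 14 * INR k ^ 10) * ln (INR k) ^ 2)%R by ring.
  apply Rle_trans with (b * (75 / 10 * 10 ^ 14 * INR k ^ 10))%R.
  - rewrite (Rmult_comm _ b). apply Rmult_le_compat_l; lra.
  - assert (0 <= b * (75 / 10 * 10 ^ 14 * INR k ^ 10))%R by (apply Rmult_le_pos; lra). nra.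
Qed.

Lemma small_odd_real_bound (k n : nat) : (3 <= k)%nat -> (n <= 50)%nat ->
  (INR n < 75 / 10 * 10 ^ 14 * (159 / 100) ^ (k * k * k) * INR k ^ 10 * (ln (INR k)) ^ 2)%R.
Proof.
  intros Hk Hn.
  assert (Hk3 : (3 <= INR k)%R) by (apply (le_INR 3) in Hk; simpl in Hk; lra).
  assert (H1 : (1 <= ln (INR k) ^ 2)%R) by (apply pow_R1_Rle, one_le_ln, Hk3).
  assert (H2 : (1 <= INR k ^ 10)%R) by (apply pow_R1_Rle; lra).
  assert (H3 : (1 <= (159 / 100) ^ (k * k * k))%R) by (apply pow_R1_Rle; lra).
  apply (le_INR n 50) in Hn. replace (INR 50) with 50%R in Hn by (simpl; lra).
  assert (H4 : (50 < 75 / 10 * 10 ^ 14)%R) by lra.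
  assert (H5 : (50 < 75 / 10 * 10 ^ 14 * (159 / 100) ^ (k * k * k))%R) by nra.
  assert (H6 : (50 < 75 / 10 * 10 ^ 14 * (159 / 100) ^ (k * k * k) * INR k ^ 10)%R) by nra.
  nra.
Qed.

Theorem theorem1p1 (k : nat) (hk : (2 <= k)%nat) (n : nat)
  (hzero : pell k (- Z.of_nat n) = 0%Z)
  (hmax : forall m : nat, pell k (- Z.of_nat m) = 0%Z -> (m <= n)%nat) :
  (Nat.Even k ->
     (INR n < 2 * INR k ^ (k * k) * ln (16 * INR k ^ 2))%R) /\
  (Nat.Odd k ->
     (INR n < 75 / 10 * 10 ^ 14 * (159 / 100) ^ (k * k * k) * INR k ^ 10
               * (ln (INR k)) ^ 2)%R).
Proof.
  clear hmax. rewrite pell_pell_rev in hzero. split; intros Hpar.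
  - apply even_real_bound; [exact hk|].
    destruct (Nat.lt_ge_cases (S n) (k * k)) as [H|H]; [lia|].
    exfalso. apply (pell_rev_even_neq0 k hk (proj2 (Nat.even_spec k) Hpar) (S n) H hzero).
  - assert (Hcases : (k = 3 \/ k = 5 \/ 7 <= k)%nat) by (destruct Hpar; lia).
    destruct Hcases as [-> | [-> | Hk]].
    (* Modulo 3, respectively 103, the sequence has period 6, respectively 51, and a term [u_r] of
       the first period that vanishes modulo [p] is 0, while [p ^ 2] does not divide [u_(r+T)]. *)
    + assert (Hn : (S n < 6)%nat).
      { apply (TwoLogarithms.pell_rev_padic (k := 3) (T := 6) (p := 3)); try lia;
          vm_compute; reflexivity. }
      apply small_odd_real_bound; lia.
    + assert (Hn : (S n < 51)%nat).
      { apply (TwoLogarithms.pell_rev_padic (k := 5) (T := 51) (p := 103)); try lia;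
          vm_compute; reflexivity. }
      apply small_odd_real_bound; lia.
    (* [(2 k^3 + 228) / 3] rounded up. *)
    + set (e := ((2 * k ^ 3 + 230) / 3)%nat).
      assert (Hd := Nat.div_mod (2 * k ^ 3 + 230) 3 ltac:(lia)).
      assert (Hm := Nat.mod_upper_bound (2 * k ^ 3 + 230) 3 ltac:(lia)).
      fold e in Hd. apply odd_real_bound with e; [exact Hk|lia|].
      destruct (Nat.lt_ge_cases n (2 ^ e)) as [H|H]; [exact H|].
      exfalso. apply (TwoLogarithms.pell_rev_large (k := k) (n := n) (e := e)); trivial; lia.
Qed.
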